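(* Let $n\ge2$ and $M\ge2$ be integers, $s\in[-1,1)$ with $C(n,M,s)\ne\emptyset$, and $h\in\mathcal{AM}([-1,1])$. Let $m=2k-1+\varepsilon$ ($\varepsilon\in\{0,1\}$) be such that $s\in I_m$, and let $f_m^{(h)}$, $L_m(n,s)$, $(\alpha_i,\rho_i)_{i=0}^{k-1+\varepsilon}$ be as in the context. For positive integers $j$ define the test functions $$R_j^{(n)}(s)=\frac1{L_m(n,s)}+\sum_{i=0}^{k-1+\varepsilon}\rho_iP_j^{(n)}(\alpha_i).$$ If $R_j^{(n)}(s)\ge0$ for every $j\ge2k+\varepsilon$, then the universal upper bound cannot be improved by using a polynomial $F\in U_h^{n,s}$ with $F(1)\le f_m^{(h)}(1)$; that is, every polynomial $F\in U_h^{n,s}$ (of any degree) with $F(1)\le f_m^{(h)}(1)$ satisfies $$M\bigl(F_0M-F(1)\bigr)\ \ge\ M\left(\frac{M}{L_m(n,s)}-1\right)f_m^{(h)}(1)+M^2\sum_{i=0}^{k-1+\varepsilon}\rho_ih(\alpha_i),$$ where $F_0$ is the zeroth Gegenbauer coefficient of $F$.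
   Context: Codes and energy. $\mathbb{S}^{n-1}$ is the unit sphere in $\mathbb{R}^n$; a spherical code is a finite subset $C\subset\mathbb{S}^{n-1}$. $E_h(C)=\sum_{x,y\in C,\,x\neq y}h(\langle x,y\rangle)$ (ordered pairs). $s(C)=\max\{\langle x,y\rangle:x,y\in C,x\ne y\}$; $C(n,M,s)=\{C\subset\mathbb{S}^{n-1}:|C|=M,\ s(C)=s\}$; $\mathcal{G}_h(n,M,s)=\sup_{C\in C(n,M,s)}E_h(C)$. Absolutely monotone potentials. $\mathcal{AM}([-1,1])$ is the set of $h:[-1,1]\to(0,+\infty]$ with $h^{(k)}(t)\ge0$ for every $t\in[-1,1)$ and every integer $k\ge0$ (so $h$ is finite and smooth on $[-1,1)$), where $h(1)=\lim_{t\to1^-}h(t)$. Gegenbauer polynomials. $P_0^{(n)}=1$, $P_1^{(n)}=t$, $(i+n-2)P_{i+1}^{(n)}(t)=(2i+n-2)tP_i^{(n)}(t)-iP_{i-1}^{(n)}(t)$ for $i\ge1$, so $P_i^{(n)}(1)=1$; they are orthogonal on $[-1,1]$ for the weight $(1-t^2)^{(n-3)/2}$. The Gegenbauer coefficients of $f\in C([-1,1])$ are $f_i=\int_{-1}^1 fP_i^{(n)}(1-t^2)^{(n-3)/2}dt\big/\int_{-1}^1 (P_i^{(n)})^2(1-t^2)^{(n-3)/2}dt$, so that $f=\sum_i f_iP_i^{(n)}$. Feasible set. $U_h^{n,s}$ is the set of $f\in C([-1,1])$ with $f(t)\ge h(t)$ for every $t\in[-1,s]$ and $f_i\le0$ for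 all $i\ge1$. Every $f\in U_h^{n,s}$ furnishes the bound $\mathcal{G}_h(n,M,s)\le M(f_0M-f(1))$; the universal upper bound is the one furnished by $f_m^{(h)}$ (defined below), which equals $M\left(\frac{M}{L_m(n,s)}-1\right)f_m^{(h)}(1)+M^2\sum_{i=0}^{k-1+\varepsilon}\rho_ih(\alpha_i)$. Levenshtein parameters. $P_i^{(\alpha,\beta)}$ denotes the Jacobi polynomial. For $a,b\in\{0,1\}$ and $i\ge1$, $t_i^{a,b}$ is the greatest zero of $P_i^{(a+\frac{n-3}2,\,b+\frac{n-3}2)}$, and $t_0^{1,1}=-1$. Set $I_{2k-1}=[t_{k-1}^{1,1},t_k^{1,0}]$ and $I_{2k}=[t_k^{1,0},t_k^{1,1}]$ for $k\ge1$; these intervals cover $[-1,1)$ and have non-overlapping interiors. Define for $s\in I_{2k-1}$, resp. $s\in I_{2k}$, $$L_{2k-1}(n,s)=\binom{k+n-3}{k-1}\left[\frac{2k+n-3}{n-1}-\frac{P_{k-1}^{(n)}(s)-P_k^{(n)}(s)}{(1-s)P_k^{(n)}(s)}\right],$$ $$L_{2k}(n,s)=\binom{k+n-2}{k}\left[\frac{2k+n-1}{n-1}-\frac{(1+s)(P_k^{(n)}(s)-P_{k+1}^{(n)}(s))}{(1-s)(P_k^{(n)}(s)+P_{k+1}^{(n)}(s))}\right].$$ Known (Levenshtein bound): any spherical code in $\mathbb{S}^{n-1}$ with all inner products of distinct points at most $s\in I_m$ has at most $L_m(n,s)$ points. Given $s\in I_m$, write $m=2k-1+\varepsilon$ with $\varepsilon\in\{0,1\}$,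 $k\ge1$. Put $Q_i^\varepsilon=P_i^{(\frac{n-1}2,\,\varepsilon+\frac{n-3}2)}$. The nodes $\alpha_0<\dots<\alpha_{k-1+\varepsilon}=s$ are the (simple) roots of $$(t+1)^\varepsilon\bigl(Q_k^\varepsilon(t)Q_{k-1}^\varepsilon(s)-Q_k^\varepsilon(s)Q_{k-1}^\varepsilon(t)\bigr)=0$$ (so $\alpha_0=-1$ if $m=2k$). The weights $\rho_0,\dots,\rho_{k-1+\varepsilon}$ are those for which Levenshtein's quadrature $$f_0=\frac{f(1)}{L_m(n,s)}+\sum_{i=0}^{k-1+\varepsilon}\rho_if(\alpha_i)$$ holds for every real polynomial $f$ of degree at most $m$. The multiset $T$, of cardinality $m$, is $\{\alpha_0,\alpha_0,\dots,\alpha_{k-2},\alpha_{k-2},\alpha_{k-1}\}$ if $m=2k-1$, and $\{\alpha_0=-1,\alpha_1,\alpha_1,\dots,\alpha_{k-1},\alpha_{k-1},\alpha_k\}$ if $m=2k$. The Levenshtein polynomial is $f_m^{(n,s)}(t)=\prod_{\alpha_i\in T}(t-\alpha_i)=\sum_{i=0}^m\ell_iP_i^{(n)}(t)$; it is known that $\ell_i>0$ for $i=0,\dots,m$. The polynomial $f_m^{(h)}$. $g_T=\sum_{i=0}^{\deg(g_T)}g_iP_i^{(n)}$ is the Hermite interpolation polynomial of degree at most $m-1$ that agrees with $h$ at the points of $T$ counted with multiplicity (both $h$ and $h'$ are interpolated at doubled points). Then $f_m^{(h)}=-\lambda f_m^{(n,s)}+g_T$ with $\lambda=\max\{g_i/\ell_i:1\le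 i\le\deg(g_T)\}$. *)

(* Defs.v *)
From HB Require Import structures.
From mathcomp Require Import all_boot all_order all_algebra finmap.
From mathcomp Require Import all_classical all_reals all_analysis.

Set Implicit Arguments.
Unset Strict Implicit.
Unset Printing Implicit Defensive.

Import Order.TTheory GRing.Theory Num.Theory.
Import numFieldNormedType.Exports.
Local Open Scope classical_set_scope.
Local Open Scope ring_scope.

Section Codes.
Variable R : realType.

Definition dotp (n : nat) (x y : 'rV[R]_n) : R := \sum_(i < n) x 0 i * y 0 i.

Definition spherical_code (n : nat) (C : {fset 'rV[R]_n}) : Prop :=
  forall x, x \in C -> dotp x x = 1.

(* s = s(C): the value s is attained by a pair of distinct points of C and
   bounds all of them. *)
Definition max_inner_product (n : nat) (C : {fset 'rV[R]_n}) (s : R) : Prop :=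
  (exists x y, [/\ x \in C, y \in C, x != y & dotp x y = s]) /\
  (forall x y, x \in C -> y \in C -> x != y -> dotp x y <= s).

Definition codes (n M : nat) (s : R) : set {fset 'rV[R]_n} :=
  [set C | [/\ spherical_code C, #|` C| = M & max_inner_product C s]].

End Codes.

Arguments codes {R} n M s.

Section Potentials.
Variable R : realType.

(* Differentiation of a function on [-1, 1[: the difference quotient only
   looks at points of [-1, 1[, so the derivative at -1 is one-sided, and
   values of f outside [-1, 1[ are irrelevant. *)
Definition diff_quot (f : R -> R) (t : R) : R -> R :=
  fun y => (f y - f t) / (y - t).

Definition derivable_co (f : R -> R) (t : R) : Prop :=
  cvg (diff_quot f t @ within [set` `[(-1 : R), 1[] t^').

Definition derive_co (f : R -> R) (t : R) : R :=
  lim (diff_quot f t @ within [set` `[(-1 : R), 1[] t^').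

Definition derive_con (k : nat) (f : R -> R) : R -> R := iter k derive_co f.

(* Only the values of h on [-1, 1] matter. *)
Definition abs_monotone (h : R -> \bar R) : Prop :=
  [/\ forall t, t \in `[(-1 : R), 1] -> (0 < h t)%E,
      forall t, t \in `[(-1 : R), 1[ -> h t \is a fin_num,
      forall k t, t \in `[(-1 : R), 1[ ->
        derivable_co (derive_con k (fine \o h)) t /\
        0 <= derive_con k (fine \o h) t
    & h t @[t --> (1 : R)^'-] --> h 1].

End Potentials.

Section Gegenbauer.
Variable R : realType.

Fixpoint gegenbauer (n i : nat) {struct i} : {poly R} :=
  match i with
  | 0 => 1
  | 1 => 'X
  | (j.+1 as i').+1 =>
      ((i' + n - 2)%:R)^-1 *:
        ((2 * i' + n - 2)%:R *: ('X * gegenbauer n i')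
          - i'%:R *: gegenbauer n j)
  end.

Definition gegen_weight (n : nat) (t : R) : R :=
  (1 - t ^+ 2) `^ ((n%:R - 3) / 2).

Definition gegen_coef (n : nat) (f : R -> R) (i : nat) : R :=
  (\int[lebesgue_measure]_(t in `[(-1 : R), 1])
      (f t * (gegenbauer n i).[t] * gegen_weight n t)) /
  (\int[lebesgue_measure]_(t in `[(-1 : R), 1])
      ((gegenbauer n i).[t] ^+ 2 * gegen_weight n t)).

(* P_i^(a,b) in the standard normalization: Szego, Orthogonal Polynomials,
   (4.21.2). *)
Definition jacobi (a b : R) (i : nat) : {poly R} :=
  (i`!%:R)^-1 *: \sum_(v < i.+1)
    ('C(i, v)%:R * (\prod_(0 <= j < v) (i%:R + a + b + 1 + j%:R)) *
     (\prod_(v <= j < i) (a + j%:R + 1))) *: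
    (2^-1 *: ('X - 1)) ^+ v.

(* The default -1 is never used: xget is applied to Jacobi polynomials of
   positive degree with parameters greater than -1. *)
Definition greatest_zero (p : {poly R}) : R :=
  xget (-1) [set x | root p x /\ forall y, root p y -> y <= x].

End Gegenbauer.

Section Levenshtein.
Variable R : realType.

(* The index m = 2k - 1 + e with k >= 1. *)
Definition lev_index (k : nat) (e : bool) : nat := (2 * k - 1 + e)%N.

Definition lev_zero (n : nat) (a b : bool) (i : nat) : R :=
  if i is 0 then -1
  else greatest_zero (jacobi (a%:R + (n%:R - 3) / 2) (b%:R + (n%:R - 3) / 2) i).

Definition lev_interval (n k : nat) (e : bool) : interval R :=
  if e then `[lev_zero n true false k, lev_zero n true true k]
  else `[lev_zero n true true k.-1, lev_zero n true false k].

Definition lev_bound (n k : nat) (e : bool) (s : R) : R :=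
  let P i := (gegenbauer R n i).[s] in
  if e then
    'C(k + n - 2, k)%:R *
      ((2 * k + n - 1)%:R / (n - 1)%:R -
       (1 + s) * (P k - P k.+1) / ((1 - s) * (P k + P k.+1)))
  else
    'C(k + n - 3, k.-1)%:R *
      ((2 * k + n - 3)%:R / (n - 1)%:R - (P k.-1 - P k) / ((1 - s) * P k)).

Definition adj_jacobi (n : nat) (e : bool) (i : nat) : {poly R} :=
  jacobi ((n%:R - 1) / 2) (e%:R + (n%:R - 3) / 2) i.

Definition node_poly (n k : nat) (e : bool) (s : R) : {poly R} :=
  let Q := adj_jacobi n e in
  ('X + 1) ^+ e * ((Q k.-1).[s] *: Q k - (Q k).[s] *: Q k.-1).

Definition lev_nodes (n k : nat) (e : bool) (s : R)
    (alpha : 'I_(k + e) -> R) : Prop :=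
  [/\ {homo alpha : i j / (i < j)%N >-> i < j},
      forall x, root (node_poly n k e s) x <-> exists i, x = alpha i
    & forall i : 'I_(k + e), i.+1 = (k + e)%N -> alpha i = s].

Definition lev_weights (n k : nat) (e : bool) (s : R)
    (alpha rho : 'I_(k + e) -> R) : Prop :=
  forall f : {poly R}, (size f <= (lev_index k e).+1)%N ->
    gegen_coef n (horner f) 0 =
      f.[1] / lev_bound n k e s + \sum_(i < k + e) rho i * f.[alpha i].

(* The last node is simple, and so is alpha_0 = -1 when e = 1; the other
   nodes are doubled. *)
Definition node_mult (k : nat) (e : bool) (i : 'I_(k + e)) : nat :=
  if (i.+1 == k + e)%N || (e && (i == 0%N :> nat)) then 1%N else 2%N.

Definition lev_multiset (k : nat) (e : bool)
    (alpha : 'I_(k + e) -> R) : seq R :=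
  flatten [seq nseq (node_mult i) (alpha i) | i <- enum 'I_(k + e)].

Definition lev_poly (k : nat) (e : bool) (alpha : 'I_(k + e) -> R) : {poly R} :=
  \prod_(a <- lev_multiset alpha) ('X - a%:P).

(* A point of multiplicity c in T imposes the values of the derivatives of
   orders 0, ..., c - 1. *)
Definition hermite_interpolant (T : seq R) (h : R -> R) (g : {poly R}) : Prop :=
  (size g <= size T)%N /\
  forall (a : R) (j : nat), (j < count_mem a T)%N ->
    g^`(j).[a] = derive_con j h a.

(* max {g_i / l_i : 1 <= i <= deg g}.  The neutral element of the iterated
   maximum is the first of its terms; if deg g = 0 the range is empty and the
   value is g_1 / l_1 = 0, since g_1 = 0. *)
Definition lev_lambda (n : nat) (l g : {poly R}) : R :=
  let r i := gegen_coef n (horner g) i / gegen_coef n (horner l) i in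
  \big[Num.max/r 1%N]_(1 <= i < size g) r i.

Definition bound_poly (n k : nat) (e : bool) (alpha : 'I_(k + e) -> R)
    (g : {poly R}) : {poly R} :=
  - (lev_lambda n (lev_poly alpha) g *: lev_poly alpha) + g.

Definition feasible (n : nat) (s : R) (h : R -> \bar R) : set (R -> R) :=
  [set f | [/\ {within `[(-1 : R), 1], continuous f},
               forall t : R, t \in `[-1, s] -> (h t <= (f t)%:E)%E
             & forall i, (1 <= i)%N -> gegen_coef n f i <= 0]].

Definition universal_upper_bound (n M k : nat) (e : bool) (s : R)
    (h : R -> \bar R) (alpha rho : 'I_(k + e) -> R) (g : {poly R}) : R :=
  M%:R * (M%:R / lev_bound n k e s - 1) * (bound_poly n alpha g).[1] +
  M%:R ^+ 2 * \sum_(i < k + e) rho i * fine (h (alpha i)).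

Definition test_function (n k : nat) (e : bool) (s : R)
    (alpha rho : 'I_(k + e) -> R) (j : nat) : R :=
  (lev_bound n k e s)^-1 +
  \sum_(i < k + e) rho i * (gegenbauer R n j).[alpha i].

End Levenshtein.

(* Main.v *)
(* Let [L f = f(1) / L_m + sum_i rho_i f(alpha_i)].  On Gegenbauer polynomials [L] is 1 at
   [P_0], 0 at [P_1, ..., P_m] and the test function [R_j] at [P_j] for [j > m].  Since
   [F_j <= 0 <= R_j], this gives [F_0 >= L F >= F(1) / L_m + sum_i rho_i h(alpha_i)],
   because the weights are nonnegative and the nodes lie in [[-1, s]].  The claim follows
   from [M / L_m - 1 <= 0] and [F(1) <= f_m(1)].

   The facts about Levenshtein's quadrature are proved from the defining data.
   - Signs of the weights and location of the nodes: evaluate the quadrature on squares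
     times [1 - t] or [1 - t^2], and on products with one polynomial orthogonal for
     [(1 - t^2) w] or [(1 - t) w], which is where the bounds on [s] enter.
   - [M <= L_m]: by the quadrature [L_m = f(1) / f_0] for the Levenshtein polynomial [f].
     By Christoffel-Darboux, [f] is a product of nonnegative combinations of Gegenbauer
     polynomials, and such products expand nonnegatively (linearization).  The Delsarte
     inequality then applies; positive definiteness of [P_i(<x, y>)] is seen by realizing
     zonal harmonics as vectors for the Fischer inner product [p(D) q]. *)
Require Import Defs.
From HB Require Import structures.
From mathcomp Require Import all_boot all_order all_algebra finmap.
From mathcomp Require Import all_classical all_reals all_analysis.
From mathcomp Require Import measurable_realfun ring lra zify.
From mathcomp Require polyrcf.
From mathcomp Require Import -(notations) mpoly.

Set Implicit Arguments.
Unset Strict Implicit.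
Unset Printing Implicit Defensive.

Import Order.TTheory GRing.Theory Num.Theory.
Import numFieldNormedType.Exports.
Local Open Scope classical_set_scope.
Local Open Scope ring_scope.

(** * Positive definiteness via the Fischer inner product *)

Section Fischer.
Variables (R : realFieldType) (n : nat).
Implicit Types (p q : mpoly n R) (x y : 'I_n -> R) (m : multinom n).

(** The nodes are given only as the increasing list of roots of [node_poly], and the weights only
    through exactness up to degree [m]; that the nodes lie in [[-1, s]], that the weights are
    nonnegative and that the Levenshtein polynomial expands nonnegatively must all be recovered from
    this. Of the integral, only linearity, positivity and the integration by parts
    [geg_integral_parts] are used; the rest follows from the recurrence, uniformly in [n], including
    [n = 2] where the weight is unbounded at the endpoints.

    The polynomials [Q_i^e] are replaced by Gegenbauer polynomials of dimension [n + 2] for [e = 1]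
    and by kernels at the point 1 for [e = 0]. Both families obey a three-term recurrence, are
    positive on [t >= 1] and expand nonnegatively in dimension [n], so one argument about zeros and
    signs serves both parities.

    For positive definiteness no basis of harmonic polynomials is chosen: on homogeneous harmonic
    polynomials of degree [i], Fischer pairing with [zonal x i] is a positive multiple of evaluation
    at [x], which turns the double sum over the code into a square. *)

Definition fischer_weight m : R := \prod_(i < n) ((m i)`!)%:R.

(** The factorial weight makes multiplication by a variable adjoint to differentiation. Summing over
    the support of [q] gives linearity in [p] at once; facts about the second argument are reached
    by expanding [p] into monomials and applying [fischer_mon]. *)
Definition fischer p q : R :=
  \sum_(m <- msupp q) fischer_weight m * mcoeff m p * mcoeff m q.

Lemma fischer_ge0 p : 0 <= fischer p p.
Proof.
apply: sumr_ge0 => m _; rewrite -mulrA mulr_ge0 ?sqr_ge0 -?expr2 //.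
by apply: prodr_ge0.
Qed.

Lemma fischerDl p1 p2 q : fischer (p1 + p2) q = fischer p1 q + fischer p2 q.
Proof.
by rewrite -big_split; apply: eq_bigr => m _ /=; rewrite mcoeffD; ring.
Qed.

Lemma fischerZl (c : R) p q : fischer (c *: p) q = c * fischer p q.
Proof.
by rewrite mulr_sumr; apply: eq_bigr => m _; rewrite mcoeffZ; ring.
Qed.

Lemma fischer0l q : fischer 0 q = 0.
Proof. by rewrite -(scale0r 0) fischerZl mul0r. Qed.

Lemma fischer_suml (I : Type) (r : seq I) (f : I -> mpoly n R) q :
  fischer (\sum_(i <- r) f i) q = \sum_(i <- r) fischer (f i) q.
Proof.
by apply: (big_morph (fischer^~ q)) => [p1 p2|]; rewrite (fischer0l, fischerDl).
Qed.

Lemma fischer0r p : fischer p 0 = 0.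
Proof. by rewrite /fischer msupp0 big_nil. Qed.

Lemma fischer_mon m q : fischer (mpolyX R m) q = fischer_weight m * mcoeff m q.
Proof.
have [mq|mq] := boolP (m \in msupp q); last first.
  rewrite /fischer big_seq big1 => [|m' m'q]; last first.
    rewrite mcoeffX; case: eqP => [e|_]; last by rewrite mulr0 mul0r.
    by rewrite e m'q in mq.
  by rewrite memN_msupp_eq0 // mulr0.
rewrite /fischer (bigD1_seq m) ?msupp_uniq //= mcoeffX eqxx mulr1.
by rewrite big1 ?addr0 // => m' /negbTE m'm; rewrite mcoeffX eq_sym m'm mulr0 mul0r.
Qed.

Lemma fischer_mulX i p q :
  fischer (mpolyX R (mnm1 i) * p) q = fischer p (mderiv i q).
Proof.
rewrite [p]mpolyE mulr_sumr !fischer_suml; apply: eq_bigr => m _.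
rewrite -scalerAr !fischerZl -mpolyXD !fischer_mon mcoeff_deriv addmC; congr (_ * _).
rewrite /fischer_weight (bigD1 i) //= [in RHS](bigD1 i) //=.
rewrite mnmDE mnm1E eqxx addn1 factS natrM -mulr_natr.
rewrite (eq_bigr (fun j => ((m j)`!)%:R : R)); first by ring.
by move=> j /negbTE ji; rewrite mnmDE mnm1E eq_sym ji addn0.
Qed.

Definition dot_form x : mpoly n R := \sum_(i < n) x i *: mpolyX R (mnm1 i).
Definition norm_form : mpoly n R :=
  \sum_(i < n) mpolyX R (mnm1 i) * mpolyX R (mnm1 i).
Definition dir_deriv x p := \sum_(i < n) x i *: mderiv i p.
Definition laplacian p := \sum_(i < n) mderiv i (mderiv i p).
Definition euler p := \sum_(i < n) mpolyX R (mnm1 i) * mderiv i p.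

Lemma fischer_dot x p q : fischer (dot_form x * p) q = fischer p (dir_deriv x q).
Proof.
rewrite mulr_suml fischer_suml.
rewrite (eq_bigr (fun i => x i * fischer p (mderiv i q))); last first.
  by move=> i _; rewrite -scalerAl fischerZl fischer_mulX.
rewrite [p]mpolyE fischer_suml.
under eq_bigr do rewrite fischer_suml mulr_sumr.
rewrite exchange_big; apply: eq_bigr => m _ /=.
rewrite fischerZl fischer_mon raddf_sum /= !mulr_sumr.
by apply: eq_bigr => i _; rewrite fischerZl fischer_mon mcoeffZ; ring.
Qed.

Lemma fischer_norm p q : fischer (norm_form * p) q = fischer p (laplacian q).
Proof.
rewrite mulr_suml fischer_suml.
rewrite (eq_bigr (fun i => fischer p (mderiv i (mderiv i q)))); last first.
  by move=> i _; rewrite -mulrA !fischer_mulX.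
rewrite [p]mpolyE fischer_suml.
under eq_bigr do rewrite fischer_suml.
rewrite exchange_big; apply: eq_bigr => m _ /=.
rewrite fischerZl fischer_mon raddf_sum /= !mulr_sumr.
by apply: eq_bigr => i _; rewrite fischerZl fischer_mon; ring.
Qed.

Lemma mderiv_var (i j : 'I_n) :
  mderiv i (mpolyX R (mnm1 j)) = (i == j)%:R.
Proof.
rewrite mderivX mnm1E eq_sym; case: eqP => [->|_]; last by rewrite scale0r.
rewrite scale1r; have -> : (mnm_sub (mnm1 j) (mnm1 j) = mnm0); last exact: mpolyX0.
by apply/mnmP => k; rewrite mnmBE subnn mnm0E.
Qed.

Lemma mderiv_sum (I : Type) (r : seq I) (f : I -> mpoly n R) i :
  mderiv i (\sum_(j <- r) f j) = \sum_(j <- r) mderiv i (f j).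
Proof. exact: (big_morph _ (mderivD i) (mderiv0 R i)). Qed.

Lemma mderiv_one i : mderiv i (1 : mpoly n R) = 0.
Proof. by rewrite -mpolyC1 mderivC. Qed.

Lemma mderiv_dot x i : mderiv i (dot_form x) = x i *: 1.
Proof.
rewrite raddf_sum /= (bigD1 i) //= mderivZ mderiv_var eqxx big1 ?addr0 // => j ji.
by rewrite mderivZ mderiv_var eq_sym (negbTE ji) scaler0.
Qed.

Lemma mderiv_norm i : mderiv i (norm_form) = 2 *: mpolyX R (mnm1 i).
Proof.
rewrite raddf_sum /= (bigD1 i) //= mderivM mderiv_var eqxx big1 ?addr0.
  by rewrite mul1r mulr1 scaler_nat.
by move=> j ji; rewrite mderivM mderiv_var eq_sym (negbTE ji) mul0r mulr0 addr0.
Qed.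

Lemma dir_deriv_is_linear x : linear (dir_deriv x).
Proof.
move=> c p q; rewrite /dir_deriv scaler_sumr -big_split; apply: eq_bigr => i _ /=.
by rewrite linearP scalerDr !scalerA mulrC.
Qed.
HB.instance Definition _ x :=
  GRing.isLinear.Build R (mpoly n R) (mpoly n R) _ (dir_deriv x)
    (dir_deriv_is_linear x).

Lemma euler_is_linear : linear euler.
Proof.
move=> c p q; rewrite /euler scaler_sumr -big_split; apply: eq_bigr => i _ /=.
by rewrite linearP mulrDr scalerAr.
Qed.
HB.instance Definition _ :=
  GRing.isLinear.Build R (mpoly n R) (mpoly n R) _ euler euler_is_linear.

Lemma laplacian_is_linear : linear laplacian.
Proof.
move=> c p q; rewrite /laplacian scaler_sumr -big_split; apply: eq_bigr => i _ /=.
by rewrite !linearP.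
Qed.
HB.instance Definition _ :=
  GRing.isLinear.Build R (mpoly n R) (mpoly n R) _ laplacian laplacian_is_linear.

Lemma dir_derivM x p q :
  dir_deriv x (p * q) = dir_deriv x p * q + p * dir_deriv x q.
Proof.
rewrite /dir_deriv mulr_suml mulr_sumr -big_split; apply: eq_bigr => i _ /=.
by rewrite mderivM scalerDr scalerAl scalerAr.
Qed.

Lemma eulerM p q : euler (p * q) = euler p * q + p * euler q.
Proof.
rewrite /euler mulr_suml mulr_sumr -big_split; apply: eq_bigr => i _ /=.
by rewrite mderivM; ring.
Qed.

Lemma euler_dot x : euler (dot_form x) = dot_form x.
Proof. by apply: eq_bigr => i _; rewrite mderiv_dot -scalerAr mulr1. Qed.

Lemma euler_norm : euler (norm_form) = 2 *: norm_form.
Proof.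
by rewrite scaler_sumr; apply: eq_bigr => i _; rewrite mderiv_norm -scalerAr.
Qed.

Lemma dir_deriv_dot x : dir_deriv x (dot_form x) = (\sum_i x i ^+ 2) *: 1.
Proof.
by rewrite scaler_suml; apply: eq_bigr => i _; rewrite mderiv_dot scalerA.
Qed.

Lemma dir_deriv_norm x : dir_deriv x (norm_form) = 2 *: dot_form x.
Proof.
rewrite scaler_sumr; apply: eq_bigr => i _.
by rewrite mderiv_norm !scalerA mulrC.
Qed.

Lemma laplacian_dotM x p :
  laplacian (dot_form x * p) = dot_form x * laplacian p + 2 *: dir_deriv x p.
Proof.
rewrite mulr_sumr scaler_sumr -big_split; apply: eq_bigr => i _ /=.
rewrite mderivM mderiv_dot mderivD !mderivM mderiv_dot.
rewrite mderivZ mderiv_one scaler0 mul0r add0r.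
rewrite -!scalerAl !mul1r scaler_nat mulr2n; ring.
Qed.

Lemma laplacian_normM p :
  laplacian (norm_form * p) =
  (2 * n%:R) *: p + 4 *: euler p + norm_form * laplacian p.
Proof.
have -> : (2 * n%:R) *: p = \sum_(i < n) 2 *: p.
  by rewrite sumr_const card_ord mulrC -scalerA scaler_nat.
rewrite mulr_sumr scaler_sumr -!big_split; apply: eq_bigr => i _ /=.
rewrite mderivM mderiv_norm mderivD !mderivM mderiv_norm mderivZ mderiv_var eqxx.
rewrite -!scalerAl !mul1r !scaler_nat; ring.
Qed.

Lemma mderiv_dir_deriv x p i :
  mderiv i (dir_deriv x p) = dir_deriv x (mderiv i p).
Proof.
rewrite /dir_deriv mderiv_sum; apply: eq_bigr => j _.
by rewrite mderivZ mderiv_comm.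
Qed.

Lemma laplacian_dir_deriv x p :
  laplacian (dir_deriv x p) = dir_deriv x (laplacian p).
Proof.
rewrite /laplacian [RHS]linear_sum /=; apply: eq_bigr => i _.
by rewrite !mderiv_dir_deriv.
Qed.

Lemma euler_dir_deriv x p :
  euler (dir_deriv x p) = dir_deriv x (euler p) - dir_deriv x p.
Proof.
apply/eqP; rewrite eq_sym subr_eq; apply/eqP.
rewrite {1}/euler [LHS]linear_sum /=.
under eq_bigr do rewrite dir_derivM.
rewrite big_split /= addrC; congr (_ + _).
  by apply: eq_bigr => j _; rewrite mderiv_dir_deriv.
rewrite {2}/dir_deriv; apply: eq_bigr => j _.
rewrite /dir_deriv (bigD1 j) //= mderiv_var eqxx big1 ?addr0 => [|i ij].
  by rewrite -scalerAl mul1r.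
by rewrite mderiv_var (negbTE ij) scaler0.
Qed.

Lemma euler_eval x p : meval x (euler p) = meval x (dir_deriv x p).
Proof.
rewrite /euler /dir_deriv !raddf_sum /=; apply: eq_bigr => i _.
by rewrite mevalM mevalXU mevalZ.
Qed.

(** Euler's identity at the point [x], iterated: each derivative in direction [x] lowers the degree
    by one, which builds up the factorial. *)
Lemma iter_dir_deriv_homog x i p : euler p = i%:R *: p ->
  meval x p * (i`!)%:R = meval x (iter i (dir_deriv x) p).
Proof.
elim: i p => [|i IH] p Ep; first by rewrite fact0 mulr1.
rewrite iterSr -IH; last first.
  by rewrite euler_dir_deriv Ep linearZ /= mulrSr scalerDl scale1r addrK.
by rewrite -euler_eval Ep mevalZ factS natrM; ring.
Qed.

(* The solid zonal harmonic [|z|^i P_i(<x, z> / |z|)] for unit [x]. *)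
Local Notation "c %:MP_[ n ]" := (mpolyC n c) : ring_scope.

Fixpoint zonal x i : mpoly n R :=
  match i with
  | 0 => 1
  | 1 => dot_form x
  | (j.+1 as i').+1 =>
      ((i' + n - 2)%:R)^-1 *:
        ((2 * i' + n - 2)%:R *: (dot_form x * zonal x i')
          - i'%:R *: (norm_form * zonal x j))
  end.

Hypothesis n_ge2 : (2 <= n)%N.

Lemma zonal0 x : zonal x 0 = 1. Proof. by []. Qed.
Lemma zonal1 x : zonal x 1 = dot_form x. Proof. by []. Qed.

Lemma natr_addB2 i : (i + n - 2)%:R = i%:R + (n - 2)%:R :> R.
Proof. by rewrite -natrD; congr (_%:R); lia. Qed.

Arguments zonal x i : simpl never.

(* For [i = 0] the junk term [zonal x 0.-1] has coefficient [0]. *)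
Lemma zonalS x i : (i%:R + (n - 2)%:R) *: zonal x i.+1 =
  (2 * i%:R + (n - 2)%:R) *: (dot_form x * zonal x i)
  - i%:R *: (norm_form * zonal x i.-1).
Proof.
case: i => [|i]; first by rewrite zonal0 zonal1 mulr1 mulr0 !add0r scale0r subr0.
rewrite -!natr_addB2 -natrM -natr_addB2 scalerA divff ?scale1r // pnatr_eq0.
lia.
Qed.

Lemma zonal_coef_neq0 i : i.+1%:R + (n - 2)%:R != 0 :> R.
Proof. by rewrite -natrD pnatr_eq0. Qed.

Lemma euler_zonal x i : euler (zonal x i) = i%:R *: zonal x i.
Proof.
elim/ltn_ind: i => -[_|[_|i IH]].
- by rewrite zonal0 scale0r /euler big1 // => j _; rewrite mderiv_one mulr0.
- by rewrite zonal1 euler_dot scale1r.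
apply: (scalerI (zonal_coef_neq0 i)); rewrite -[LHS]linearZ /= zonalS.
rewrite [RHS]scalerA [X in _ = X *: _]mulrC -[RHS]scalerA zonalS linearB !linearZ /=.
rewrite !eulerM euler_dot euler_norm !IH //.
by rewrite -!mul_mpolyC; ring.
Qed.

(** Evaluates the cross term that [laplacian_dotM] produces; harmonicity of [zonal x i] rests on
    it. *)
Lemma dir_deriv_zonal x i : \sum_i x i ^+ 2 = 1 ->
  dir_deriv x (zonal x i) = i%:R *: zonal x i.-1.
Proof.
move=> x1; elim/ltn_ind: i => -[_|[_|i IH]].
- by rewrite zonal0 scale0r /dir_deriv big1 // => j _; rewrite mderiv_one scaler0.
- by rewrite zonal1 dir_deriv_dot x1.
apply: (scalerI (zonal_coef_neq0 i)); rewrite -[LHS]linearZ /= zonalS.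
rewrite linearB !linearZ /= !dir_derivM dir_deriv_norm dir_deriv_dot x1 !IH //=.
have := zonalS x i; rewrite -!mul_mpolyC => E.
transitivity ((2 * i.+1%:R + (n - 2)%:R)%:MP_[n] * zonal x i.+1
  + i.+1%:R%:MP_[n] * ((i%:R + (n - 2)%:R)%:MP_[n] * zonal x i.+1)); last by ring.
by rewrite E; ring.
Qed.

Lemma laplacian_zonal x i : \sum_i x i ^+ 2 = 1 -> laplacian (zonal x i) = 0.
Proof.
move=> x1; elim/ltn_ind: i => -[_|[_|i IH]].
- by rewrite zonal0 /laplacian big1 // => j _; rewrite mderiv_one mderiv0.
- rewrite zonal1 /laplacian big1 // => j _.
  by rewrite mderiv_dot mderivZ mderiv_one scaler0.
apply: (scalerI (zonal_coef_neq0 i)); rewrite -[LHS]linearZ /= zonalS scaler0.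
rewrite linearB !linearZ /= laplacian_dotM laplacian_normM !IH // dir_deriv_zonal //=.
rewrite euler_zonal -!mul_mpolyC.
have -> : n%:R = (n - 2)%:R + 2 :> R by rewrite -natrD subnK.
by ring.
Qed.

Lemma meval_zonal x y i : \sum_i y i ^+ 2 = 1 ->
  (i%:R + (n - 2)%:R) * meval y (zonal x i.+1) =
  (2 * i%:R + (n - 2)%:R) * ((\sum_i x i * y i) * meval y (zonal x i))
  - i%:R * meval y (zonal x i.-1).
Proof.
move=> y1; rewrite -mevalZ zonalS mevalB !mevalZ !mevalM.
congr (_ * (_ * _) - _ * _).
  by rewrite raddf_sum /=; apply: eq_bigr => j _; rewrite mevalZ mevalXU.
rewrite [X in X * _](_ : _ = 1) ?mul1r // -y1 raddf_sum /=; apply: eq_bigr => j _.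
by rewrite mevalM mevalXU expr2.
Qed.

(* The leading coefficient of [P_i]. *)
Definition zonal_const (i : nat) : R :=
  \prod_(0 <= j < i) (if j == 0%N then 1
                     else (2 * j%:R + (n - 2)%:R) / (j%:R + (n - 2)%:R)).

Lemma zonal_const_gt0 i : 0 < zonal_const i.
Proof.
apply: prodr_gt0 => -[|j] _ //=; apply: divr_gt0;
  by rewrite -?natrM -natrD ltr0n.
Qed.

Lemma euler_mon m : euler (mpolyX R m) = (mdeg m)%:R *: mpolyX R m.
Proof.
rewrite mdegE natr_sum scaler_suml; apply: eq_bigr => i _.
rewrite mderivX -scalerAr -mpolyXD addmC.
have [->|mi] := eqVneq (m i) 0%N; first by rewrite !scale0r.
rewrite submK //; apply/mnm_lepP => j; rewrite mnm1E.
by case: eqP => [<-|//]; rewrite lt0n.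
Qed.

Lemma mcoeff_euler m p : mcoeff m (euler p) = (mdeg m)%:R * mcoeff m p.
Proof.
rewrite [p]mpolyE [euler _]linear_sum !(big_morph _ (mcoeffD m) (mcoeff0 _ m)).
rewrite mulr_sumr; apply: eq_bigr => k _ /=.
rewrite linearZ /= euler_mon !mcoeffZ mcoeffX.
by case: eqP => [->|_]; rewrite ?mulr0 ?mulr1 /= 1?mulrC ?mul0r.
Qed.

Lemma euler_eq0 p : euler p = 0 -> p = (mcoeff mnm0 p)%:MP_[n].
Proof.
move=> Ep; apply/mpolyP => m; rewrite mcoeffC.
have [->|m0] := eqVneq m mnm0; first by rewrite mulr1.
have /eqP := mcoeff_euler m p; rewrite Ep mcoeff0 eq_sym mulf_eq0 pnatr_eq0.
by rewrite mdeg_eq0 (negbTE m0) mulr0 /= => /eqP.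
Qed.

(* Modulo [norm_form], a zonal harmonic is a multiple of a power of [dot_form x],
   and multiples of [norm_form] are orthogonal to harmonic polynomials. *)
Lemma fischer_zonal x i q : laplacian q = 0 -> euler q = i%:R *: q ->
  fischer (zonal x i) q = zonal_const i * (i`!)%:R * meval x q.
Proof.
move=> Lq Eq; rewrite -mulrA [_%:R * _]mulrC (iter_dir_deriv_homog _ Eq).
elim: i q Lq Eq => [|i IH] q Lq Eq.
  rewrite /zonal_const big_nil mul1r zonal0 -mpolyX0 fischer_mon.
  rewrite [in RHS](euler_eq0 (p := q)) ?mevalC; last by rewrite Eq scale0r.
  by rewrite /fischer_weight big1 ?mul1r // => j _; rewrite mnm0E.
have LD : laplacian (dir_deriv x q) = 0 by rewrite laplacian_dir_deriv Lq raddf0.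
have ED : euler (dir_deriv x q) = i%:R *: dir_deriv x q.
  by rewrite euler_dir_deriv Eq linearZ /= mulrSr scalerDl scale1r addrK.
have := IH _ LD ED; rewrite iterSr => E.
rewrite /zonal_const big_nat_recr //= -/(zonal_const i) mulrAC -E -fischer_dot.
(* From degree 0 to degree 1 [zonalS] reads [0 = 0] when [n = 2]; hence the separate case, and the
   factor 1 at [j = 0] in [zonal_const]. *)
case: i {IH Eq LD ED E} => [|i]; first by rewrite zonal1 zonal0 !mulr1.
apply: (mulfI (zonal_coef_neq0 i)); rewrite -fischerZl zonalS.
rewrite -scaleNr fischerDl !fischerZl fischer_norm Lq fischer0r mulr0 addr0 /=.
move: (zonal_coef_neq0 i); set a := (i.+1%:R + _); move: a => a a0.
by field.
Qed.

(** Evaluation at [x a] is, up to a positive constant independent of [a], the Fischer pairing with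
    [zonal (x a) i], so the double sum is a positive multiple of the squared norm of [W]. *)
Lemma zonal_psd (I : Type) (r : seq I) (x : I -> 'I_n -> R) i :
  (forall a, \sum_j x a j ^+ 2 = 1) ->
  0 <= \sum_(a <- r) \sum_(b <- r) meval (x a) (zonal (x b) i).
Proof.
move=> x1; pose W := \sum_(b <- r) zonal (x b) i.
have LW : laplacian W = 0.
  by rewrite raddf_sum /= big1 // => b _; exact: laplacian_zonal.
have EW : euler W = i%:R *: W.
  by rewrite /W [LHS]linear_sum scaler_sumr; apply: eq_bigr => b _; exact: euler_zonal.
have k0 : 0 < zonal_const i * (i`!)%:R.
  by rewrite mulr_gt0 ?zonal_const_gt0 // ltr0n fact_gt0.
rewrite -(pmulr_rge0 _ k0) mulr_sumr.
suff -> : \sum_(a <- r) zonal_const i * (i`!)%:R *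
    (\sum_(b <- r) meval (x a) (zonal (x b) i)) = fischer W W by exact: fischer_ge0.
rewrite [in RHS]/W fischer_suml; apply: eq_bigr => a _.
by rewrite fischer_zonal // raddf_sum.
Qed.

End Fischer.

(** * Gegenbauer polynomials *)

Section GegenbauerRecurrence.
Variables (R : realType) (n : nat).
Hypothesis n_ge2 : (2 <= n)%N.
Local Notation P := (gegenbauer R n).
Implicit Types (t : R) (i j k : nat).

(** These are the coefficients of ['X * P i = a i *: P i.+1 + c i *: P i.-1]; they sum to 1 because
    every [P i] is 1 at the point 1. For [n = 2] and [i = 0] the quotient is [0 / 0 = 0], the value
    wanted. *)
Definition geg_down i : R := i%:R / (2 * i%:R + (n - 2)%:R).
Definition geg_up i : R := 1 - geg_down i.
Local Notation c := geg_down.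
Local Notation a := geg_up.

Lemma geg_down0 : c 0 = 0.
Proof. by rewrite /geg_down mul0r. Qed.

Lemma geg_up0 : a 0 = 1.
Proof. by rewrite /geg_up geg_down0 subr0. Qed.

Lemma geg_den_gt0 i : 0 < 2 * i.+1%:R + (n - 2)%:R :> R.
Proof. by rewrite -natrM -natrD ltr0n. Qed.

Lemma geg_down_gt0 i : 0 < c i.+1.
Proof. by rewrite divr_gt0 ?geg_den_gt0 // ltr0n. Qed.

Lemma geg_down_ge0 i : 0 <= c i.
Proof. by case: i => [|i]; rewrite ?geg_down0 // ltW ?geg_down_gt0. Qed.

Lemma geg_down_le_half i : c i <= 2^-1.
Proof.
case: i => [|i]; first by rewrite geg_down0 invr_ge0.
rewrite ler_pdivrMr ?geg_den_gt0 //.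
have : 0 <= (n - 2)%:R :> R by [].
lra.
Qed.

Lemma geg_up_ge_half i : 2^-1 <= a i.
Proof. by have := geg_down_le_half i; rewrite /geg_up; lra. Qed.

Lemma geg_up_gt0 i : 0 < a i.
Proof. by have := geg_up_ge_half i; lra. Qed.

Lemma geg_down_leS i : c i <= c i.+1.
Proof.
case: i => [|i]; first by rewrite geg_down0 geg_down_ge0.
rewrite ler_pdivrMr ?geg_den_gt0 // mulrAC ler_pdivlMr ?geg_den_gt0 //.
have : 0 <= (n - 2)%:R :> R by [].
by rewrite -!natr1; nra.
Qed.

Lemma geg_down_homo : {homo c : i j / (i <= j)%N >-> i <= j}.
Proof. exact: homo_leq le_trans geg_down_leS. Qed.

Lemma gegenbauer0 : P 0 = 1. Proof. by []. Qed.
Lemma gegenbauer1 : P 1 = 'X. Proof. by []. Qed.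

(* For [i = 0] the junk term [P 0.-1] has coefficient [0]. *)
Lemma gegenbauerS i : (i%:R + (n - 2)%:R) *: P i.+1 =
  (2 * i%:R + (n - 2)%:R) *: ('X * P i) - i%:R *: P i.-1.
Proof.
case: i => [|i]; first by rewrite /= mulr1 mulr0 scale0r subr0.
rewrite -!natrM -!natrD !addnBA // [P i.+2]/= scalerA divff ?scale1r // pnatr_eq0.
lia.
Qed.

Local Opaque gegenbauer.

Lemma geg_coef_neq0 i : i.+1%:R + (n - 2)%:R != 0 :> R.
Proof. by rewrite -natrD pnatr_eq0. Qed.

Lemma gegenbauer_mulX i : 'X * P i = a i *: P i.+1 + c i *: P i.-1.
Proof.
case: i => [|i].
  by rewrite geg_up0 geg_down0 scale1r scale0r addr0 gegenbauer0 mulr1.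
have d0 := geg_den_gt0 i; apply: (scalerI (lt0r_neq0 d0)).
rewrite scalerDr [X in _ = X + _]scalerA [X in _ = _ + X]scalerA.
have -> : (2 * i.+1%:R + (n - 2)%:R) * c i.+1 = i.+1%:R.
  by rewrite mulrC divfK ?lt0r_neq0.
have -> : (2 * i.+1%:R + (n - 2)%:R) * a i.+1 = i.+1%:R + (n - 2)%:R.
  by rewrite /geg_up /geg_down; field; rewrite lt0r_neq0.
by rewrite gegenbauerS subrK.
Qed.

Lemma gegenbauer_horner i t :
  t * (P i).[t] = a i * (P i.+1).[t] + c i * (P i.-1).[t].
Proof.
by have /(congr1 (horner^~ t)) := gegenbauer_mulX i; rewrite !hornerE.
Qed.

Lemma gegenbauer_at1 i : (P i).[1] = 1.
Proof.
elim/ltn_ind: i => -[|[|i]] IH.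
- by rewrite gegenbauer0 hornerE.
- by rewrite gegenbauer1 hornerE.
have := gegenbauer_horner i.+1 1; rewrite /= (IH i.+1) // (IH i) // !mulr1 /geg_up => E.
by apply: (mulfI (lt0r_neq0 (geg_up_gt0 i.+1))); rewrite /geg_up; lra.
Qed.

Lemma gegenbauer_ge1 i t : 1 <= t -> 1 <= (P i).[t].
Proof.
move=> t1; suff: 1 <= (P i).[t] <= (P i.+1).[t] by case/andP.
elim: i => [|i /andP[IH1 IH2]]; first by rewrite gegenbauer0 gegenbauer1 !hornerE lexx.
rewrite (le_trans IH1) //=; have := gegenbauer_horner i.+1 t => /= E.
rewrite -(ler_pM2l (geg_up_gt0 i.+1)) -subr_ge0.
have -> : a i.+1 * (P i.+2).[t] - a i.+1 * (P i.+1).[t] =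
    (t - 1) * (P i.+1).[t] + c i.+1 * ((P i.+1).[t] - (P i).[t]).
  by rewrite -[a _ * (P i.+2).[t]](addrK (c i.+1 * (P i).[t])) -E /geg_up; ring.
by rewrite addr_ge0 // mulr_ge0 ?geg_down_ge0 ?subr_ge0 //; lra.
Qed.

Lemma gegenbauerN i t : (P i).[- t] = (-1) ^+ i * (P i).[t].
Proof.
elim/ltn_ind: i => -[|[|i]] IH.
- by rewrite gegenbauer0 expr0 mul1r !hornerC.
- by rewrite gegenbauer1 expr1 mulN1r !hornerX.
apply: (mulfI (lt0r_neq0 (geg_up_gt0 i.+1))).
have H x : a i.+1 * (P i.+2).[x] = x * (P i.+1).[x] - c i.+1 * (P i).[x].
  by rewrite gegenbauer_horner /= addrK.
by rewrite [RHS]mulrCA !H (IH i.+1) // (IH i) // !exprS; ring.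
Qed.

Lemma gegenbauer_leN1 i t : t <= -1 -> 1 <= (-1) ^+ i * (P i).[t].
Proof.
move=> t1; rewrite -[t]opprK gegenbauerN mulrA -expr2 sqrr_sign mul1r.
by apply: gegenbauer_ge1; lra.
Qed.

Lemma size_gegenbauer i : size (P i) = i.+1.
Proof.
elim/ltn_ind: i => -[|[|i]] IH.
- by rewrite gegenbauer0 size_poly1.
- by rewrite gegenbauer1 size_polyX.
have a0 := lt0r_neq0 (geg_up_gt0 i.+1).
have E : a i.+1 *: P i.+2 = 'X * P i.+1 - c i.+1 *: P i.
  by rewrite gegenbauer_mulX /= addrK.
rewrite -(size_scale _ a0) E.
have S : size ('X * P i.+1) = i.+3.
  by rewrite mulrC size_mulX ?IH // -size_poly_eq0 IH.
rewrite size_polyDl // S size_polyN (leq_ltn_trans (size_scale_leq _ _)) //.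
by rewrite IH.
Qed.

Lemma gegenbauer_deriv i :
  (1 - 'X^2) * (P i)^`() = i%:R *: (P i.-1 - 'X * P i).
Proof.
elim/ltn_ind: i => -[|[|i]] IH.
- by rewrite gegenbauer0 derivC scale0r mulr0.
- by rewrite gegenbauer1 gegenbauer0 derivX scale1r mulr1 expr2.
apply: (scalerI (geg_coef_neq0 i)).
have D : (i.+1%:R + (n - 2)%:R) *: (P i.+2)^`() =
   (2 * i.+1%:R + (n - 2)%:R) *: (P i.+1 + 'X * (P i.+1)^`()) - i.+1%:R *: (P i)^`().
  by rewrite -derivZ gegenbauerS derivB !derivZ derivM derivX mul1r.
have H1 := IH i.+1 (ltnSn _); have H0 := IH i (ltnW (ltnSn _)).
have S1 := gegenbauerS i; have S2 := gegenbauerS i.+1.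
rewrite scalerAr D.
move: H1 H0 S1 S2; rewrite -!mul_polyC /= => H1 H0 S1 S2.
transitivity ((2 * i.+1%:R + (n - 2)%:R)%:P * ((1 - 'X^2) * P i.+1
   + 'X * ((1 - 'X^2) * (P i.+1)^`())) - i.+1%:R%:P * ((1 - 'X^2) * (P i)^`())).
  by ring.
rewrite H1 H0.
transitivity (i.+2%:R%:P * ((i.+1%:R + (n - 2)%:R)%:P * P i.+1 -
   'X * ((i.+1%:R + (n - 2)%:R)%:P * P i.+2))); last by ring.
rewrite S2.
have -> : i%:R%:P * (P i.-1 - 'X * P i) =
   (2 * i%:R + (n - 2)%:R)%:P * ('X * P i) - (i%:R + (n - 2)%:R)%:P * P i.+1
     - i%:R%:P * ('X * P i) by rewrite S1; ring.
by ring.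
Qed.

End GegenbauerRecurrence.

(** * Linearization of products, and kernels at the point 1 *)

Section GegenbauerKernels.
Variables (R : realType) (n : nat).
Hypothesis n_ge2 : (2 <= n)%N.
Local Notation P := (gegenbauer R n).
Local Notation c := (geg_down R n).
Local Notation a := (geg_up R n).
Implicit Types (t : R) (i j k d : nat).
Local Opaque gegenbauer.

(* Up to constants the left side is [(1 - 'X^2) * (P k.+1)^`()], by [gegenbauer_deriv]. *)
Lemma gegenbauer_add2 k :
  (n - 1)%:R *: (P k - 'X * P k.+1) =
  (k + n - 1)%:R *: ((1 - 'X^2) * gegenbauer R (n + 2) k).
Proof.
have n2 : (2 <= n + 2)%N by lia.
have -> : (k + n - 1)%:R = k%:R + 1 + (n - 2)%:R :> R.
  by rewrite natr1 -natrD; congr (_%:R); lia.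
have -> : (n - 1)%:R = 1 + (n - 2)%:R :> R.
  by rewrite nat1r; congr (_%:R); lia.
elim/ltn_ind: k => -[|k] IH.
  by rewrite !gegenbauer0 gegenbauer1 add0r mulr1 expr2.
have e : (n + 2 - 2)%:R = (n - 2)%:R + 2 :> R by rewrite -natrD; congr (_%:R); lia.
have G := gegenbauerS R n2 k; have E := gegenbauerS R n_ge2 k.+1.
have IHk1 : k%:R *: ((1 - 'X^2) * gegenbauer R (n + 2) k.-1) =
    (1 + (n - 2)%:R) *: ('X * P k - P k.+1).
  case: k {G E} IH => [_|k IH].
    by rewrite gegenbauer0 gegenbauer1 mulr1 subrr scale0r scaler0.
  apply: (scalerI (geg_coef_neq0 R n k)).
  have := IH k (ltnW (ltnSn k.+1)); have := gegenbauerS R n_ge2 k.+1.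
  rewrite /= -!mul_polyC => E IHk.
  transitivity (k.+1%:R%:P * ((k%:R + 1 + (n - 2)%:R)%:P *
    ((1 - 'X^2) * gegenbauer R (n + 2) k))); first by rewrite -!natr1; ring.
  rewrite -IHk.
  transitivity ((1 + (n - 2)%:R)%:P * ((k.+1%:R + (n - 2)%:R)%:P * ('X * P k.+1)
     - (k.+1%:R + (n - 2)%:R)%:P * P k.+2)); last by ring.
  by rewrite E; ring.
have IHk := IH k (ltnSn k).
apply: (scalerI (geg_coef_neq0 R n k)).
move: E G IHk IHk1; rewrite e -!mul_polyC /= => E G IHk IHk1.
transitivity ((k.+1%:R + (n - 2)%:R)%:P * ((1 - 'X^2) *
   ((k%:R + ((n - 2)%:R + 2))%:P * gegenbauer R (n + 2) k.+1))); last first.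
  by rewrite -!natr1; ring.
rewrite G.
transitivity ((2 * k%:R + ((n - 2)%:R + 2))%:P * 'X * ((k%:R + 1 + (n - 2)%:R)%:P *
    ((1 - 'X^2) * gegenbauer R (n + 2) k))
    - ((k%:R + 1 + (n - 2)%:R)%:P *
       (k%:R%:P * ((1 - 'X^2) * gegenbauer R (n + 2) k.-1)))); last first.
  by rewrite -!natr1; ring.
rewrite -IHk IHk1.
transitivity ((1 + (n - 2)%:R)%:P * ((k.+1%:R + (n - 2)%:R)%:P * P k.+1 -
   'X * ((k.+1%:R + (n - 2)%:R)%:P * P k.+2))); first by ring.
by rewrite E -!natr1; ring.
Qed.

(* [L 1 / L (P i ^+ 2)] for the orthogonality functional [L]; the scaled polynomials
   are then the terms of the reproducing kernel at 1. *)
Fixpoint geg_mass i : R :=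
  if i is j.+1 then geg_mass j * a j / c j.+1 else 1.
Local Notation r := geg_mass.

Lemma geg_massS i : r i.+1 * c i.+1 = r i * a i.
Proof. by rewrite /= divfK // lt0r_neq0 // geg_down_gt0. Qed.

Lemma geg_mass0 : r 0 = 1. Proof. by []. Qed.

Lemma geg_mass_gt0 i : 0 < r i.
Proof.
elim: i => [|i IH] //=.
by rewrite divr_gt0 ?mulr_gt0 ?geg_up_gt0 ?geg_down_gt0.
Qed.

Arguments geg_mass : simpl never.

Definition geg_scaled i : {poly R} := r i *: P i.
Local Notation Pt := geg_scaled.

Lemma geg_scaled0 : Pt 0 = 1.
Proof. by rewrite /geg_scaled geg_mass0 scale1r gegenbauer0. Qed.

(** Rescaling by the mass transposes the Jacobi matrix: [c] now goes up and [a] goes down. *)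
Lemma geg_scaled_mulX i :
  'X * Pt i.+1 = c i.+2 *: Pt i.+2 + a i *: Pt i.
Proof.
rewrite /geg_scaled -scalerAr gegenbauer_mulX // scalerDr !scalerA geg_massS.
by rewrite -[r i.+1 * a _]geg_massS [r i.+2 * _]mulrC [a i * _]mulrC.
Qed.

Lemma geg_scaled1 : c 1 *: Pt 1 = 'X.
Proof.
rewrite /geg_scaled scalerA mulrC geg_massS geg_mass0 geg_up0 mulr1 scale1r.
exact: gegenbauer1.
Qed.

(** Inductive rather than a condition on coefficients: indices may repeat, and closure under sums
    and products as well as the energy estimate are inductions on the derivation. *)
Inductive geg_cone : {poly R} -> Prop :=
| geg_cone0 : geg_cone 0
| geg_cone_cons x i p : 0 <= x -> geg_cone p -> geg_cone (x *: P i + p).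

Lemma geg_coneD p q : geg_cone p -> geg_cone q -> geg_cone (p + q).
Proof.
by move=> hp hq; elim: hp => [|x i p' x0 _ IH]; rewrite ?add0r // -addrA; constructor.
Qed.

Lemma geg_coneZ x p : 0 <= x -> geg_cone p -> geg_cone (x *: p).
Proof.
move=> x0; elim=> [|y i p' y0 _ IH]; first by rewrite scaler0; constructor.
by rewrite scalerDr scalerA; constructor; rewrite // mulr_ge0.
Qed.

Lemma geg_cone_sum (I : eqType) (s : seq I) (f : I -> {poly R}) :
  (forall z, z \in s -> geg_cone (f z)) -> geg_cone (\sum_(z <- s) f z).
Proof.
move=> fs; rewrite big_seq; apply: (big_ind geg_cone) => //; first exact: geg_cone0.
exact: geg_coneD.
Qed.

Lemma geg_cone_P i : geg_cone (P i).
Proof. by rewrite -[P i]addr0 -[P i]scale1r; constructor => //; constructor. Qed.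

Lemma geg_cone_scaled i : geg_cone (Pt i).
Proof. by apply: geg_coneZ; [exact/ltW/geg_mass_gt0|exact: geg_cone_P]. Qed.

(* Linearization with manifestly nonnegative coefficients, after Szwarc: sum the
   discrete wave equation [a_i u(i+1,j) + c_i u(i-1,j) = a_j u(i,j+1) + c_j u(i,j-1)]
   over the triangle below [(d + j, j)]; interior terms cancel since [a_i + c_i = 1]. *)
Lemma geg_linearization j d :
  c j *: (Pt (d + j) * Pt j) =
  \sum_(q < j) (a (d + q) - c q) *: (Pt (d + q) * Pt q) +
  \sum_(q < j) (c (d + j + (j - q)) - c q) *: (Pt (d + j + (j - q)) * Pt q).
Proof.
pose left d J := \sum_(q < J) (a (d + q) - c q) *: (Pt (d + q) * Pt q).
pose right e J := \sum_(q < J) (c (e - q) - c q) *: (Pt (e - q) * Pt q).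
rewrite -/(left d j).
have -> : \sum_(q < j) (c (d + j + (j - q)) - c q) *: (Pt (d + j + (j - q)) * Pt q)
          = right (d + j + j)%N j.
  by apply: eq_bigr => q _; rewrite addnBA // ltnW.
elim/ltn_ind: j d => -[|[|j]] IH d.
- by rewrite geg_down0 scale0r /left /right !big_ord0 addr0.
- rewrite /left /right !big_ord1 !addn0 subn0 geg_down0 !subr0 geg_scaled0 !mulr1.
  rewrite scalerAr geg_scaled1 mulrC addn1 geg_scaled_mulX addrC !addn1.
  by [].
(* The triangle below [(d + j.+2, j.+2)] is covered by those below its two neighbours in row [j.+1],
   which overlap in the one below [(d + j.+2, j)]: inclusion-exclusion. *)
have I1 := IH j.+1 (ltnSn _) d.+2; have I2 := IH j.+1 (ltnSn _) d.
have I0 := IH j (ltnW (ltnSn j.+1)) d.+2.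
have X1 := geg_scaled_mulX j; have X2 := geg_scaled_mulX (d + j.+1).
have S1 : left d.+2 j.+1 = left d.+2 j +
    (a (d.+2 + j) - c j) *: (Pt (d.+2 + j) * Pt j) by rewrite /left big_ord_recr.
have S2 : left d j.+2 = left d j.+1 +
    (a (d + j.+1) - c j.+1) *: (Pt (d + j.+1) * Pt j.+1) by rewrite /left big_ord_recr.
have S3 : right (d + j.+1 + j.+1)%N j.+1 = right (d.+2 + j + j)%N j +
    (c (d.+2 + j) - c j) *: (Pt (d.+2 + j) * Pt j).
  rewrite /right big_ord_recr /=.
  by have -> : (d + j.+1 + j.+1 = d.+2 + j + j)%N; [lia|rewrite addnK].
have S4 : right (d + j.+2 + j.+2)%N j.+2 = right (d.+2 + j.+1 + j.+1)%N j.+1 +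
    (c (d.+2 + j.+1) - c j.+1) *: (Pt (d.+2 + j.+1) * Pt j.+1).
  rewrite /right big_ord_recr /=.
  by have -> : (d + j.+2 + j.+2 = d.+2 + j.+1 + j.+1)%N; [lia|rewrite addnK].
rewrite S2 S4; move: I1 I2 I0; rewrite S1 S3.
have e0 : (d.+2 + j = (d + j).+2)%N by lia.
have e1 : (d + j.+1 = (d + j).+1)%N by lia.
have e2 : (d + j.+2 = (d + j).+2)%N by lia.
have e3 : (d.+2 + j.+1 = (d + j).+3)%N by lia.
move: X1 X2; rewrite e0 e1 e2 e3 => X1 X2.
set L0 := left _ j; set L1 := left _ j.+1; set R0 := right _ j.
set R1 := right _ j.+1 => I1 I2 I0.
have aE k : a k = 1 - c k by [].
move: X1 X2 I1 I2 I0; rewrite !aE -!mul_polyC => X1 X2 I1 I2 I0.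
have -> : (c j.+2)%:P * (Pt (d + j).+2 * Pt j.+2) = Pt (d + j).+2 *
   ((c j.+2)%:P * Pt j.+2 + (1 - c j)%:P * Pt j - (1 - c j)%:P * Pt j) by ring.
rewrite -X1.
have -> : Pt (d + j).+2 * ('X * Pt j.+1 - (1 - c j)%:P * Pt j) =
   'X * Pt (d + j).+2 * Pt j.+1 - (1 - c j)%:P * (Pt (d + j).+2 * Pt j) by ring.
rewrite X2.
have L1E : L1 = (c j.+1)%:P * (Pt (d + j).+1 * Pt j.+1) -
   (R0 + (c (d + j).+2 - c j)%:P * (Pt (d + j).+2 * Pt j)) by rewrite I2; ring.
have R1E : R1 = (c j.+1)%:P * (Pt (d + j).+3 * Pt j.+1) -
   (L0 + (1 - c (d + j).+2 - c j)%:P * (Pt (d + j).+2 * Pt j)) by rewrite I1; ring.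
have L0E : L0 = (c j)%:P * (Pt (d + j).+2 * Pt j) - R0 by rewrite I0; ring.
by rewrite R1E L1E L0E; ring.
Qed.

(** Strong induction on the smaller index, since [geg_linearization] leaves only second factors
    [q < j]. Its left coefficients are nonnegative because [c <= 1/2 <= a], the right ones because
    [c] is nondecreasing. *)
Lemma geg_coneM_scaled i j : geg_cone (Pt i * Pt j).
Proof.
have H d k : geg_cone (Pt (d + k) * Pt k).
  elim/ltn_ind: k d => {i j} -[|j] IH d.
    by rewrite geg_scaled0 mulr1; exact: geg_cone_scaled.
  have c0 := geg_down_gt0 R n j.
  rewrite -[Pt _ * _](scalerK (lt0r_neq0 c0)); apply: geg_coneZ.
    by rewrite invr_ge0 ltW.
  rewrite geg_linearization; apply: geg_coneD; apply: geg_cone_sum => q _;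
    apply: geg_coneZ.
  - have := geg_up_ge_half R n (d + q); have := geg_down_le_half R n q; lra.
  - exact: IH.
  - by rewrite subr_ge0; apply: geg_down_homo; have := ltn_ord q; lia.
  - have -> : (d + j.+1 + (j.+1 - q) = (d + (j.+1 - q) + (j.+1 - q)) + q)%N.
      by have := ltn_ord q; lia.
    exact: IH.
case: (leqP j i) => [ji|/ltnW ij]; first by rewrite -(subnK ji).
by rewrite -(subnK ij) mulrC.
Qed.

Lemma geg_scaledK i : P i = (r i)^-1 *: Pt i.
Proof. by rewrite scalerK // lt0r_neq0 // geg_mass_gt0. Qed.

Lemma geg_coneM p q : geg_cone p -> geg_cone q -> geg_cone (p * q).
Proof.
have r0 i : 0 <= (r i)^-1 by rewrite invr_ge0 ltW // geg_mass_gt0.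
move=> hp hq; elim: hp => [|x i p' x0 _ IH]; first by rewrite mul0r; constructor.
rewrite mulrDl -scalerAl; apply: geg_coneD => //; apply: geg_coneZ => // {IH p'}.
elim: hq => [|y j q' y0 _ IH]; first by rewrite mulr0; constructor.
rewrite mulrDr -scalerAr; apply: geg_coneD => //; apply: geg_coneZ => //.
rewrite !geg_scaledK -scalerAl -scalerAr; do 2 apply: geg_coneZ => //.
exact: geg_coneM_scaled.
Qed.

(* The kernel of [P_0, ..., P_i] at the point 1, orthogonal for [(1 - t) w]. *)
Definition geg_kernel i : {poly R} := \sum_(j < i.+1) Pt j.
Local Notation K := geg_kernel.

Lemma geg_kernelS i : K i.+1 = K i + Pt i.+1.
Proof. by rewrite /geg_kernel big_ord_recr. Qed.

Lemma geg_kernel0 : K 0 = 1.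
Proof. by rewrite /geg_kernel big_ord1 geg_scaled0. Qed.

Lemma geg_cone_kernel i : geg_cone (K i).
Proof. by apply: geg_cone_sum => j _; exact: geg_cone_scaled. Qed.

(** Christoffel-Darboux at the point 1. It is the source both of orthogonality of [K i] for
    [(1 - t) w] and of its sign on [t <= -1]. *)
Lemma geg_kernel_sub i : (1 - 'X) * K i = (r i * a i) *: (P i - P i.+1).
Proof.
elim: i => [|i IH].
  rewrite geg_kernel0 geg_up0 geg_mass0 mulr1 scale1r mulr1.
  by rewrite gegenbauer0 gegenbauer1.
rewrite geg_kernelS mulrDr IH mulrBl mul1r /geg_scaled -scalerAr gegenbauer_mulX //=.
rewrite -geg_massS -!mul_polyC.
have -> : a i.+1 = 1 - c i.+1 by [].
by ring.
Qed.

(** The last coefficient is cut off at [i = 0] because [K 0.-1] is [K 0] while [a 0 = 1]. *)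
Lemma geg_kernel_mulX i : 'X * K i =
  c i.+1 *: K i.+1 + (c i - c i.+1) *: K i + (if i is 0 then 0 else a i) *: K i.-1.
Proof.
elim: i => [|i IH].
  rewrite geg_kernelS geg_kernel0 mulr1 geg_down0 sub0r scale0r addr0 scalerDr geg_scaled1.
  by rewrite scaleNr addrAC subrr add0r.
rewrite geg_kernelS mulrDr IH geg_scaled_mulX.
rewrite [K i.+2]geg_kernelS [K i.+1]geg_kernelS.
case: i {IH} => [|i].
  rewrite geg_up0 scale0r geg_kernel0 geg_scaled0 -!mul_polyC /geg_up geg_down0; ring.
rewrite /= [K i.+1]geg_kernelS.
have -> : a i.+1 = 1 - c i.+1 by [].
have -> : a i.+2 = 1 - c i.+2 by [].
by rewrite -!mul_polyC; ring.
Qed.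

Lemma geg_kernel_gt0 i t : 1 <= t -> 0 < (K i).[t].
Proof.
move=> t1; elim: i => [|i IH]; first by rewrite geg_kernel0 hornerC.
rewrite geg_kernelS hornerD addr_gt0 // hornerZ mulr_gt0 ?geg_mass_gt0 //.
by have := gegenbauer_ge1 n_ge2 i.+1 t1; lra.
Qed.

Lemma geg_kernel_leN1 i t : t <= -1 -> 0 < (-1) ^+ i * (K i).[t].
Proof.
move=> t1; have /(congr1 (horner^~ t)) := geg_kernel_sub i.
rewrite !hornerE => E.
have t2 : 0 < 1 - t by lra.
have ra0 : 0 < r i * a i by rewrite mulr_gt0 ?geg_mass_gt0 ?geg_up_gt0.
rewrite -(pmulr_rgt0 _ t2) mulrCA E mulrCA (pmulr_rgt0 _ ra0).
have := gegenbauer_leN1 n_ge2 i t1; have := gegenbauer_leN1 n_ge2 i.+1 t1.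
by rewrite exprS; lra.
Qed.

(* The terms of the kernel at 1 of the parity of [i]: the kernel for [(1 - t^2) w]. *)
Fixpoint geg_parity_kernel i : {poly R} :=
  match i with
  | 0 => Pt 0
  | 1 => Pt 1
  | j.+2 => geg_parity_kernel j + Pt i
  end.

Lemma geg_parity_kernel_sub i :
  (1 - 'X^2) * geg_parity_kernel i = (r i * a i) *: (P i - 'X * P i.+1).
Proof.
elim/ltn_ind: i => -[|[|i]] IH.
- rewrite [geg_parity_kernel 0]geg_scaled0 gegenbauer1 gegenbauer0 geg_up0 geg_mass0.
  by rewrite mulr1 scale1r; ring.
- have /= := gegenbauer_mulX R n_ge2 1; rewrite gegenbauer1 gegenbauer0 => E.
  have r1 : r 1 * c 1 = 1 by rewrite geg_massS geg_up0 geg_mass0 mulr1.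
  rewrite /= /geg_scaled gegenbauer1.
  transitivity (r 1 *: ('X - 'X * ('X * 'X)) : {poly R}).
    by rewrite -!mul_polyC; ring.
  rewrite E -scalerA; congr (_ *: _); rewrite -!mul_polyC.
  have -> : a 1 = 1 - c 1 by [].
  by ring.
rewrite [geg_parity_kernel _]/(geg_parity_kernel i + Pt i.+2) mulrDr IH //.
have E1 := gegenbauer_mulX R n_ge2 i.+1; have E2 := gegenbauer_mulX R n_ge2 i.+2.
have rr1 := geg_massS i.+1; have rr0 := geg_massS i.
rewrite -rr0 /geg_scaled; move: E1 E2; rewrite -!mul_polyC /= => E1 E2.
transitivity ((r i.+1)%:P * ((c i.+1)%:P * P i) - (r i.+1 * c i.+1)%:P * ('X * P i.+1)
  + (r i.+2)%:P * (P i.+2 - 'X * ('X * P i.+2))); first by ring.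
have -> : (c i.+1)%:P * P i = 'X * P i.+1 - (a i.+1)%:P * P i.+2 by rewrite E1; ring.
rewrite E2.
have -> : (r i.+1)%:P * ('X * P i.+1 - (a i.+1)%:P * P i.+2) =
  (r i.+1)%:P * ('X * P i.+1) - (r i.+2 * c i.+2)%:P * P i.+2 by rewrite rr1; ring.
have -> : (r i.+1 * c i.+1)%:P * ('X * P i.+1) =
  (r i.+1)%:P * ('X * P i.+1) - (r i.+2 * c i.+2)%:P * ('X * P i.+1).
  by rewrite rr1 /geg_up; ring.
by rewrite /geg_up; ring.
Qed.

Lemma geg_cone_parity_kernel i : geg_cone (geg_parity_kernel i).
Proof.
elim/ltn_ind: i => -[|[|i]] IH; [exact: geg_cone_scaled..|].
by apply: geg_coneD; [exact: IH|exact: geg_cone_scaled].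
Qed.

(** After multiplication by [1 - 'X^2], the polynomial of dimension [n + 2] and the parity kernel
    are both positive multiples of [P i - 'X * P i.+1], hence proportional. *)
Lemma geg_cone_add2 i : geg_cone (gegenbauer R (n + 2) i).
Proof.
have k0 : 0 < (i + n - 1)%:R :> R by rewrite ltr0n; lia.
have m0 : r i * a i != 0 by rewrite mulf_neq0 ?lt0r_neq0 ?geg_mass_gt0 ?geg_up_gt0.
suff -> : gegenbauer R (n + 2) i =
    ((n - 1)%:R / (i + n - 1)%:R / (r i * a i)) *: geg_parity_kernel i.
  apply: geg_coneZ (geg_cone_parity_kernel i).
  by rewrite !divr_ge0 // mulr_ge0 ?ltW ?geg_mass_gt0 ?geg_up_gt0.
have X0 : 1 - 'X^2 != 0 :> {poly R}.
  by rewrite subr_eq0 eq_sym -subr_eq0 monic_neq0 // monicXnsubC.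
apply: (mulfI X0); apply: (scalerI (lt0r_neq0 k0)); rewrite -gegenbauer_add2.
rewrite -scalerAr geg_parity_kernel_sub !scalerA; congr (_ *: _).
by rewrite -mulrA (divfK m0) mulrC divfK // lt0r_neq0.
Qed.

End GegenbauerKernels.

(** * Zeros of polynomials with a three-term recurrence *)

Section GreatestRoot.
Variable R : rcfType.
Implicit Types (p : {poly R}) (x z t : R).

Definition greatest_root p z := root p z /\ forall x, root p x -> x <= z.

Lemma exists_greatest_root p x : p != 0 -> root p x ->
  exists2 z, greatest_root p z & x <= z.
Proof.
elim: {p}(size p) {-2}p x (leqnn (size p)) => [|m IH] p x sp p0 px.
  by move: sp p0; rewrite leqn0 size_poly_eq0 => ->.
have [hx|/existsNP[x']] := pselect (forall x', root p x' -> x' <= x).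
  by exists x.
move=> /not_implyP[px' /negP]; rewrite -ltNge => xx'.
case/factor_theorem: px => q pE.
have q0 : q != 0 by apply: contraNneq p0 => q0; rewrite pE q0 mul0r.
have qx' : root q x'.
  by move: px'; rewrite pE rootM root_XsubC (gt_eqF xx') orbF.
have sq : (size q <= m)%N.
  by move: sp; rewrite pE size_Mmonic ?monicXsubC // size_XsubC addn2.
have [z [qz zmax] x'z] := IH _ _ sq q0 qx'.
exists z; last by rewrite (le_trans (ltW xx')).
split=> [|y]; first by rewrite pE rootM qz.
rewrite pE rootM root_XsubC => /orP[/zmax//|/eqP->].
exact: le_trans (ltW xx') x'z.
Qed.

Lemma horner_gt0_beyond p z x t : (forall y, root p y -> y <= z) ->
  0 < p.[x] -> z <= x -> z < t -> 0 < p.[t].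
Proof.
move=> pz px zx zt; rewrite ltNge; apply/negP => pt.
have [tx|xt] := leP t x.
  have [y /andP[ty _] /pz yz] := @poly_ivt R p _ _ tx (introT andP (conj pt (ltW px))).
  by have := lt_le_trans zt (le_trans ty yz); rewrite ltxx.
have pt' : (- p).[x] <= 0 <= (- p).[t] by rewrite !hornerN oppr_le0 oppr_ge0 pt ltW.
have [y /andP[xy _]] := @poly_ivt R (- p) _ _ (ltW xt) pt'.
rewrite rootN => ry; have yx := le_trans (pz _ ry) zx.
have e : y = x by apply/le_anti; rewrite yx xy.
by move: ry; rewrite e rootE (gt_eqF px).
Qed.

Lemma lead_coef_gt0 p z : (forall t, z < t -> 0 < p.[t]) -> 0 < lead_coef p.
Proof.
move=> pz.
have p0 : p != 0.
  have : 0 < p.[z + 1] by apply: pz; rewrite ltrDl.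
  by apply: contraTneq => ->; rewrite horner0 ltxx.
rewrite lt_neqAle eq_sym lead_coef_eq0 p0 leNgt; apply/negP => lp.
have : 0 < lead_coef (- p) by rewrite lead_coefN oppr_gt0.
case/polyrcf.poly_pinfty_gt_lc => b hb.
have /hb : Num.max b (z + 1) >= b by rewrite le_max lexx.
rewrite lead_coefN hornerN => H.
have : 0 < p.[Num.max b (z + 1)] by apply: pz; rewrite lt_max ltrDl ltr01 orbT.
by move: H lp; lra.
Qed.

End GreatestRoot.

Section ThreeTermRecurrence.
Variables (R : rcfType) (y : nat -> {poly R}) (A B C : nat -> R).
Hypothesis y0 : y 0%N = 1.
Hypothesis A_gt0 : forall i, 0 < A i.
Hypothesis C0 : C 0%N = 0.
Hypothesis C_gt0 : forall i, 0 < C i.+1.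
Hypothesis y_mulX :
  forall i, 'X * y i = A i *: y i.+1 + B i *: y i + C i *: y i.-1.
Hypothesis size_y : forall i, size (y i) = i.+1.
Hypothesis y_gt0 : forall i t, 1 <= t -> 0 < (y i).[t].
Implicit Types (s t z : R) (i k : nat).

(** Proportional to the reciprocal squared norms, but read off from the recurrence alone, so that
    both adjacent families are covered without an inner product. *)
Fixpoint cd_mass i : R := if i is j.+1 then cd_mass j * A j / C j.+1 else 1.
Local Notation d := cd_mass.

Lemma cd_mass_gt0 i : 0 < d i.
Proof. by elim: i => //= i IH; rewrite divr_gt0 ?mulr_gt0. Qed.

Lemma cd_massS i : d i.+1 * C i.+1 = d i * A i.
Proof. by rewrite /= divfK // lt0r_neq0. Qed.

Lemma cd_mass0 : d 0 = 1. Proof. by []. Qed.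
Arguments cd_mass : simpl never.

Definition cd_sum k s : {poly R} := \sum_(i < k.+1) (d i * (y i).[s]) *: y i.

Lemma y_horner i s : s * (y i).[s] =
  A i * (y i.+1).[s] + B i * (y i).[s] + C i * (y i.-1).[s].
Proof. by have /(congr1 (horner^~ s)) := y_mulX i; rewrite !hornerE. Qed.

Lemma christoffel_darboux k s : ('X - s%:P) * cd_sum k s =
  (d k * A k) *: ((y k).[s] *: y k.+1 - (y k.+1).[s] *: y k).
Proof.
elim: k => [|k IH].
  rewrite /cd_sum big_ord1 /= cd_mass0 y0 hornerC.
  have := y_mulX 0; have := y_horner 0 s; rewrite /= C0 y0 hornerC => es eX.
  have {}es : s = A 0 * (y 1).[s] + B 0 by move: es; lra.
  have {}eX : 'X = (A 0)%:P * y 1 + (B 0)%:P.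
    by rewrite -[LHS]mulr1 eX -!mul_polyC; ring.
  by rewrite -!mul_polyC {1}eX {1}es; ring.
rewrite /cd_sum big_ord_recr mulrDr -/(cd_sum k s) IH /= -!mul_polyC -cd_massS.
have es := y_horner k.+1 s; have eX := y_mulX k.+1.
rewrite /= in es eX; move: eX; rewrite -!mul_polyC => eX.
transitivity ((d k.+1 * C k.+1)%:P * (((y k).[s])%:P * y k.+1 - ((y k.+1).[s])%:P * y k)
  + (d k.+1)%:P * (((y k.+1).[s])%:P * ('X * y k.+1) - (s * (y k.+1).[s])%:P * y k.+1)).
  by ring.
by rewrite eX es; ring.
Qed.

Lemma cd_sum_gt0 k s : 0 < (cd_sum k s).[s].
Proof.
rewrite horner_sum big_ord_recl /= cd_mass0 y0 !hornerE ltr_wpDr // sumr_ge0 // => i _.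
by rewrite hornerZ -mulrA mulr_ge0 ?(ltW (cd_mass_gt0 _)) // -expr2 sqr_ge0.
Qed.

Lemma y_neq0 i : y i != 0.
Proof.
by apply: contraTneq (y_gt0 i (lexx 1)) => ->; rewrite horner0 ltxx.
Qed.

Lemma y_beyond i z t : (forall x, root (y i) x -> x <= z) -> z < t -> 0 < (y i).[t].
Proof.
move=> iz zt; apply: (horner_gt0_beyond iz _ _ zt (x := Num.max z 1)).
  by apply: y_gt0; rewrite le_max lexx orbT.
by rewrite le_max lexx.
Qed.

(* Divide Christoffel-Darboux at [s = z] by [X - z] and evaluate at [z]. *)
Lemma y_pred_gt0 k z : greatest_root (y k.+1) z -> 0 < (y k).[z].
Proof.
move=> [rz zmax]; have /rootP yz := rz; case/factor_theorem: rz => q qE.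
have qz : 0 <= q.[z].
  rewrite leNgt; apply/negP => qz.
  have q1 : 0 <= q.[z + 1].
    have : 0 < (y k.+1).[z + 1] by apply: (y_beyond zmax); rewrite ltrDl.
    by rewrite qE hornerM hornerXsubC addrAC subrr add0r mulr1 => /ltW.
  have zz1 : z <= z + 1 by rewrite lerDl.
  have [x /andP[zx _] /rootP qx] :=
    @poly_ivt R q z (z + 1) zz1 (introT andP (conj (ltW qz) q1)).
  have xz : x <= z by apply: zmax; rewrite rootE qE hornerM qx mul0r.
  have e : x = z by apply/le_anti; rewrite xz.
  by move: qz; rewrite -e qx ltxx.
have := christoffel_darboux k z; rewrite yz scale0r subr0 qE.
rewrite [q * _]mulrC !scalerAr => /(mulfI (monic_neq0 (monicXsubC z))) H.
have := cd_sum_gt0 k z; rewrite H !hornerZ.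
have dA : 0 < d k * A k by rewrite mulr_gt0 ?cd_mass_gt0.
rewrite (pmulr_rgt0 _ dA) => H'.
rewrite ltNge; apply/negP => yk; move: H'; rewrite ltNge => /negP; apply.
exact: mulr_le0_ge0.
Qed.

(** At a zero of [y k.+1] the recurrence forces opposite signs on [y k.+2] and [y k]; this is what
    makes the greatest zeros increase with the degree. *)
Lemma y_succ_lt0 k z : greatest_root (y k.+1) z -> (y k.+2).[z] < 0.
Proof.
move=> zk; have yk := y_pred_gt0 zk; have [/rootP yz _] := zk.
have := y_horner k.+1 z; rewrite yz !mulr0 addr0 /= => E.
rewrite -(pmulr_rlt0 _ (A_gt0 k.+1)).
have -> : A k.+1 * (y k.+2).[z] = - (C k.+1 * (y k).[z]).
  by apply/eqP; rewrite -addr_eq0 -E.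
by rewrite oppr_lt0 mulr_gt0.
Qed.

Lemma y_greatest_root k : exists z, greatest_root (y k.+1) z.
Proof.
elim: k => [|k [z zk]].
  have [||z zr _] := @exists_greatest_root R (y 1) (B 0); last by exists z.
    exact: y_neq0.
  have := y_horner 0 (B 0); rewrite /= C0 y0 hornerC => E.
  rewrite rootE -(mulrI_eq0 _ (lregP (lt0r_neq0 (A_gt0 0)))).
  by apply/eqP; move: E; lra.
have yz := y_succ_lt0 zk.
have zm : z <= Num.max z 1 by rewrite le_max lexx.
have ym : 0 < (y k.+2).[Num.max z 1] by apply: y_gt0; rewrite le_max lexx orbT.
have [x _ rx] := @poly_ivt R _ _ _ zm (introT andP (conj (ltW yz) (ltW ym))).
by have [||w wr _] := @exists_greatest_root R (y k.+2) x; [exact: y_neq0| |exists w].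
Qed.

Lemma greatest_root_ltS k z z' : greatest_root (y k.+1) z ->
  greatest_root (y k.+2) z' -> z < z'.
Proof.
move=> zk [/rootP yz' zmax]; have yz := y_succ_lt0 zk.
rewrite ltNge le_eqVlt; apply/negP => /orP[/eqP e|z'z].
  by move: yz; rewrite -e yz' ltxx.
by have := lt_trans (y_beyond zmax z'z) yz; rewrite ltxx.
Qed.

Lemma y_ge0_beyond k z s i : greatest_root (y k.+1) z -> z <= s -> (i <= k.+1)%N ->
  0 <= (y i).[s].
Proof.
elim: k z => [|k IH] z zk zs; rewrite leq_eqVlt => /predU1P[->|ik].
1,3: have [/rootP yz zmax] := zk; move: zs; rewrite le_eqVlt => /predU1P[<-|zs];
  [by rewrite yz | exact/ltW/(y_beyond zmax)].
  by case: i ik => // _; rewrite y0 hornerC.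
have [z' zk'] := y_greatest_root k.
apply: (IH z') => //; exact: le_trans (ltW (greatest_root_ltS zk' zk)) zs.
Qed.

(* [s] is the last zero of the quasi-orthogonal polynomial through it. *)
Lemma quasi_orthogonal_signs k s z :
  (forall x, root ((y k).[s] *: y k.+1 - (y k.+1).[s] *: y k) x -> x <= s) ->
  greatest_root (y k.+1) z -> s <= z ->
  (forall i, (i <= k)%N -> 0 <= (y i).[s]) /\ (y k.+1).[s] <= 0.
Proof.
set p := _ - _ => ps zk sz.
have dA : 0 < d k * A k by rewrite mulr_gt0 ?cd_mass_gt0.
have CD : ('X - s%:P) * cd_sum k s = (d k * A k) *: p := christoffel_darboux k s.
have ppos t : s < t -> 0 < p.[t].
  move=> st; have /(congr1 (horner^~ t)) := CD.
  rewrite hornerM hornerXsubC hornerZ => E; rewrite -(pmulr_rgt0 _ dA) -E.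
  rewrite mulr_gt0 ?subr_gt0 //; apply: (@horner_gt0_beyond _ _ s s) => //.
    move=> x; rewrite rootE => /eqP rx; apply: ps; rewrite rootE.
    by rewrite -(mulrI_eq0 _ (lregP (lt0r_neq0 dA))) -hornerZ -CD hornerM rx mulr0.
  exact: cd_sum_gt0.
have yk := y_pred_gt0 zk; have [/rootP yz zmax] := zk.
have ps0 : p.[s] = 0 by rewrite /p !hornerE mulrC subrr.
have p_ge0 t : s <= t -> 0 <= p.[t].
  by rewrite le_eqVlt => /predU1P[<-|/ppos/ltW//]; rewrite ps0.
(* At [z] only the term [- (y k.+1).[s] * (y k).[z]] of [p] survives, and [(y k).[z]] is
   positive. *)
have v0 : (y k.+1).[s] <= 0.
  have := p_ge0 z sz; rewrite /p !hornerE yz mulr0 sub0r oppr_ge0.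
  by rewrite pmulr_lle0.
split=> // i ik.
(* Otherwise [p] would have a negative leading coefficient while being positive beyond [s]. *)
have u0 : 0 <= (y k).[s].
  rewrite leNgt; apply/negP => u0.
  have : 0 < lead_coef p by exact: lead_coef_gt0 ppos.
  rewrite lead_coefDl; last first.
    rewrite size_polyN (leq_ltn_trans (size_scale_leq _ _)) // size_scale ?lt_eqF //.
    by rewrite !size_y.
  rewrite lead_coefZ nmulr_rgt0 // ltNge ltW //.
  by apply: (@lead_coef_gt0 _ _ 1) => t t1; rewrite y_gt0 // ltW.
have [k0|k0] := posnP k.
  by move: ik; rewrite k0 leqn0 => /eqP->; rewrite y0 hornerC.
(* The greatest zero [z'] of [y k] is at most [s]: otherwise [p] is positive at [z'], where it
   reduces to [(y k).[s] * (y k.+1).[z'] <= 0]. *)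
have [z' zk'] := y_greatest_root k.-1.
apply: (y_ge0_beyond zk'); rewrite ?prednK // leNgt; apply/negP => /ppos.
have [/rootP yz' _] := zk'.
have := y_succ_lt0 zk'; rewrite prednK // in yz' * => yz2.
rewrite /p !hornerE yz' mulr0 subr0 ltNge => /negP; apply.
by rewrite mulr_ge0_le0 // ltW.
Qed.

End ThreeTermRecurrence.

(** * Jacobi polynomials in terms of Gegenbauer polynomials *)

Section JacobiGegenbauer.
Variables (R : realType) (n : nat).
Hypothesis n_ge2 : (2 <= n)%N.
Local Notation P := (gegenbauer R n).
Local Notation K := (geg_kernel R n).
Local Notation D := ((n - 2)%:R : R).
Implicit Types (i j v : nat).
Local Opaque gegenbauer.

Let U : {poly R} := 2^-1 *: ('X - 1).
Let F i v : R := \prod_(0 <= j < v) (i%:R - j%:R).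
Let G i v : R := \prod_(0 <= j < v) (i%:R + D + j%:R).
Let H v : R := \prod_(0 <= j < v) ((D + 1) / 2 + j%:R).

Let FS i v : F i v.+1 = F i v * (i%:R - v%:R).
Proof. by rewrite /F big_nat_recr. Qed.

Let FSl i v : F i.+1 v.+1 = i.+1%:R * F i v.
Proof.
rewrite /F big_nat_recl // subr0; congr (_ * _); apply: eq_bigr => j _.
by rewrite -!natr1; ring.
Qed.

Let GS i v : G i v.+1 = G i v * (i%:R + D + v%:R).
Proof. by rewrite /G big_nat_recr. Qed.

Let GSl i v : G i v.+1 = (i%:R + D) * G i.+1 v.
Proof.
rewrite /G big_nat_recl // addr0; congr (_ * _); apply: eq_bigr => j _.
by rewrite -!natr1; ring.
Qed.

Let HS v : H v.+1 = H v * ((D + 1) / 2 + v%:R).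
Proof. by rewrite /H big_nat_recr. Qed.

Let HS_gt0 v : 0 < (D + 1) / 2 + v%:R.
Proof. by rewrite ltr_wpDr // divr_gt0 // ltr_wpDl. Qed.

Let H_gt0 v : 0 < H v.
Proof. by rewrite /H prodr_gt0. Qed.

Let F_small i v : (i < v)%N -> F i v = 0.
Proof.
move=> iv; apply/eqP; rewrite /F prodf_seq_eq0; apply/hasP; exists i.
  by rewrite mem_index_iota.
by rewrite subrr eqxx.
Qed.

Let F_bin i v : 'C(i, v)%:R = F i v / (v`!)%:R.
Proof.
have v0 : (v`!)%:R != 0 :> R by rewrite pnatr_eq0 -lt0n fact_gt0.
rewrite -[LHS](mulfK v0) -natrM bin_ffact; congr (_ / _).
elim: v {v0} => [|v IH]; first by rewrite /F big_nil.
rewrite ffactnSr natrM IH FS; have [vi|iv] := leqP v i; first by rewrite natrB.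
by rewrite F_small // !mul0r.
Qed.

(** Coefficients of [2F1(-i, i + n - 2; (n - 1)/2; (1 - t)/2)] in powers of [U = (t - 1)/2]; the
    signs of the rising factorial of [-i] and of [(1 - t)^v] cancel. *)
Let p i v : R := F i v * G i v / ((v`!)%:R * H v).

Let p0 i : p i 0 = 1.
Proof. by rewrite /p /F /G /H !big_nil fact0 mul1r invr1 mul1r. Qed.

Let fact_neq0 v : (v`!)%:R != 0 :> R.
Proof. by rewrite pnatr_eq0 -lt0n fact_gt0. Qed.

Let p_rec i v : (i.+1%:R + D) * p i.+2 v.+1 =
  (2 * i.+1%:R + D) * (p i.+1 v.+1 + 2 * p i.+1 v) - i.+1%:R * p i v.+1.
Proof.
have E : (i.+1%:R + D) * G i.+2 v.+1 =
    G i.+1 v * (i.+1%:R + D + v%:R) * (i.+2%:R + D + v%:R).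
  by rewrite GS mulrA -GSl GS.
have E2 : i.+1%:R * F i v.+1 = F i.+1 v * (i.+1%:R - v%:R) * (i%:R - v%:R).
  by rewrite FS mulrA -FSl FS.
have f0 := fact_neq0 v; have h0 := lt0r_neq0 (H_gt0 v).
have h1 := lt0r_neq0 (HS_gt0 v); have nv : v.+1%:R != 0 :> R by rewrite pnatr_eq0.
rewrite /p; set W := (_ * H v.+1)^-1; set W' := (_ * H v)^-1.
have WE : W' = v.+1%:R * ((D + 1) / 2 + v%:R) * W.
  rewrite /W /W' factS natrM HS; move: f0 h0 h1 nv.
  set a := (v`!)%:R; set b := H v; set c := _ + v%:R; set e := v.+1%:R.
  by move: a b c e => a b c e *; field; apply/and4P.
transitivity (F i.+2 v.+1 * ((i.+1%:R + D) * G i.+2 v.+1) * W); first by ring.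
rewrite E FSl WE FS (GS i.+1 v).
transitivity ((2 * i.+1%:R + D) * (F i.+1 v * (i.+1%:R - v%:R) *
    (G i.+1 v * (i.+1%:R + D + v%:R)) * W +
    2 * (F i.+1 v * G i.+1 v * (v.+1%:R * ((D + 1) / 2 + v%:R) * W))) -
    (i.+1%:R * F i v.+1) * G i v.+1 * W); last by ring.
by rewrite E2 (GSl i v) -!natr1; field.
Qed.

(** The range [N] is free so that the three consecutive polynomials of the recurrence can be summed
    over one range. *)
Let expansion i N : (i < N)%N -> P i = \sum_(v < N) p i v *: U ^+ v.
Proof.
have XU : 'X = 1 + 2 *: U by rewrite /U scalerA divff ?pnatr_eq0 // scale1r addrC subrK.
have p_small j v : (j < v)%N -> p j v = 0.
  by move=> jv; rewrite /p F_small // !mul0r.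
elim/ltn_ind: i N => -[|[|i]] IH [//|N] iN.
- rewrite big_ord_recl p0 expr0 scale1r gegenbauer0 big1 ?addr0 // => v _.
  by rewrite p_small ?scale0r.
- case: N iN => // N _; rewrite 2!big_ord_recl p0 expr0 scale1r big1 => [|v _]; last first.
    by rewrite p_small ?scale0r.
  rewrite addr0 expr1 gegenbauer1 XU /= /p FS GS HS /F /G /H !big_nil factS fact0.
  congr (_ + _ *: _); rewrite !mul1r !mulr1n subr0 !addr0.
  by field; rewrite natr1 pnatr_eq0.
apply: (scalerI (geg_coef_neq0 R n i)); rewrite gegenbauerS //=.
have PE k : (k < i.+2)%N -> P k = 1 + \sum_(v < N) p k v.+1 *: U ^+ v.+1.
  move=> ki; rewrite (IH k ki N.+1); last by rewrite (leq_trans ki) // ltnW.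
  by rewrite big_ord_recl p0 expr0 scale1r.
have UP : U * P i.+1 = \sum_(v < N) p i.+1 v *: U ^+ v.+1.
  rewrite (IH i.+1 _ N) // mulr_sumr; apply: eq_bigr => v _.
  by rewrite -scalerAr exprS.
have XP : 'X * P i.+1 = P i.+1 + 2 *: (U * P i.+1).
  by rewrite {1}XU -!mul_polyC; ring.
have -> : \sum_(v < N.+1) p i.+2 v *: U ^+ v =
    1 + \sum_(v < N) p i.+2 v.+1 *: U ^+ v.+1.
  by rewrite big_ord_recl p0 expr0 scale1r.
rewrite XP UP.
rewrite (PE i) ?(PE i.+1) ?leqnSn //.
suff E : (i.+1%:R + D) *: (\sum_(v < N) p i.+2 v.+1 *: U ^+ v.+1) =
    (2 * i.+1%:R + D) *: (\sum_(v < N) p i.+1 v.+1 *: U ^+ v.+1 +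
      2 *: (\sum_(v < N) p i.+1 v *: U ^+ v.+1)) -
    i.+1%:R *: (\sum_(v < N) p i v.+1 *: U ^+ v.+1).
  by rewrite [RHS]scalerDr E -!mul_polyC; ring.
rewrite !scaler_sumr -big_split scaler_sumr -sumrB; apply: eq_bigr => v _ /=.
by rewrite !scalerA p_rec -!mul_polyC; ring.
Qed.

Let H_cat v i : (v <= i)%N -> H v * \prod_(v <= j < i) ((D + 1) / 2 + j%:R) = H i.
Proof. by move=> vi; rewrite /H -big_cat_nat. Qed.

Lemma jacobi_gegenbauer i :
  exists2 x, 0 < x & jacobi ((n%:R - 3) / 2) ((n%:R - 3) / 2) i = x *: P i.
Proof.
exists (H i / (i`!)%:R); first by rewrite divr_gt0 ?ltr0n ?fact_gt0.
have nD : n%:R = D + 2 :> R by rewrite -natrD subnK.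
rewrite (expansion (ltnSn i)) /jacobi -/U [H _ / _]mulrC -[RHS]scalerA; congr (_ *: _).
rewrite scaler_sumr; apply: eq_bigr => v _; rewrite scalerA; congr (_ *: _).
rewrite /p F_bin -(H_cat (ltn_ord v : v <= i)%N).
have -> : \prod_(0 <= j < v) (i%:R + (n%:R - 3) / 2 + (n%:R - 3) / 2 + 1 + j%:R) = G i v.
  by apply: eq_bigr => j _; rewrite nD; field.
have -> : \prod_(v <= j < i) ((n%:R - 3) / 2 + j%:R + 1) =
    \prod_(v <= j < i) ((D + 1) / 2 + j%:R).
  by apply: eq_bigr => j _; rewrite nD; field.
have f0 := fact_neq0 v; have h0 := lt0r_neq0 (H_gt0 v).
by field; rewrite ?f0 ?h0.
Qed.

(** Both sides are proportional to [P i.+1 - P i] divided by [1 - 'X]: the Jacobi sum by comparing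
    hypergeometric coefficients, the kernel by [geg_kernel_sub]. *)
Lemma jacobi_kernel i :
  exists2 x, 0 < x & jacobi ((n%:R - 1) / 2) ((n%:R - 3) / 2) i = x *: K i.
Proof.
have nD : n%:R = D + 2 :> R by rewrite -natrD subnK.
pose q v := F i v / (v`!)%:R * G i.+1 v / H v.+1.
pose Q := \sum_(v < i.+1) q v *: U ^+ v.
have JE : jacobi ((n%:R - 1) / 2) ((n%:R - 3) / 2) i = (H i.+1 / (i`!)%:R) *: Q.
  rewrite /jacobi -/U [H _ / _]mulrC -[RHS]scalerA; congr (_ *: _).
  rewrite scaler_sumr; apply: eq_bigr => v _; rewrite scalerA; congr (_ *: _).
  rewrite /q F_bin -(H_cat (ltn_ord v : v.+1 <= i.+1)%N).
  have -> : \prod_(0 <= j < v) (i%:R + (n%:R - 1) / 2 + (n%:R - 3) / 2 + 1 + j%:R) =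
      G i.+1 v.
    by apply: eq_bigr => j _; rewrite nD -natr1; field.
  have -> : \prod_(v <= j < i) ((n%:R - 1) / 2 + j%:R + 1) =
      \prod_(v.+1 <= j < i.+1) ((D + 1) / 2 + j%:R).
    by rewrite big_add1; apply: eq_bigr => j _; rewrite nD -natr1; field.
  have f0 := fact_neq0 v; have h0 := lt0r_neq0 (H_gt0 v.+1).
  by field; rewrite ?f0 ?h0.
pose m := (2 * i%:R + 1 + D).
have m0 : 0 < m by rewrite /m -addrA ltr_wpDl ?mulr_ge0 // ltr_wpDr.
have PQ : P i.+1 - P i = m *: (U * Q).
  rewrite (expansion (ltnSn i.+1)) (expansion (leqnSn i.+1 : i < i.+2)%N).
  rewrite -sumrB big_ord_recl !p0 subrr add0r mulr_sumr scaler_sumr.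
  apply: eq_bigr => v _ /=.
  rewrite -scalerBl -scalerAr -exprS scalerA; congr (_ *: _).
  rewrite /p /q FSl FS !GS [in RHS]/m
    (_ : G i v * (i%:R + D + v%:R) = (i%:R + D) * G i.+1 v).
    rewrite factS natrM -!natr1.
    have f0 := fact_neq0 v; have h0 := lt0r_neq0 (H_gt0 v.+1).
    have v0 : v%:R + 1 != 0 :> R by rewrite natr1 pnatr_eq0.
    by field; rewrite f0 h0.
  by rewrite -GSl GS.
have ra0 : 0 < geg_mass R n i * geg_up R n i.
  by rewrite mulr_gt0 ?geg_mass_gt0 ?geg_up_gt0.
exists (2 / m / (geg_mass R n i * geg_up R n i) * (H i.+1 / (i`!)%:R)).
  by rewrite mulr_gt0 ?divr_gt0 ?ltr0n ?fact_gt0.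
rewrite JE [X in _ = X *: _]mulrC -[RHS]scalerA; congr (_ *: _).
have X0 : (1 - 'X : {poly R}) != 0.
  by rewrite -opprB oppr_eq0 monic_neq0 // monicXsubC.
apply: (mulfI X0); rewrite -[RHS]scalerAr geg_kernel_sub // -[P i - _]opprB PQ.
rewrite scalerN -scaleNr !scalerA.
have -> : 1 - 'X = - 2 *: U by rewrite /U scalerA mulNr divff // scaleN1r opprB.
rewrite -scalerAl; congr (_ *: _).
move: (lt0r_neq0 ra0) (lt0r_neq0 m0).
by move: (_ * geg_up _ _ _) (m) => x y x0 y0; field; rewrite ?x0 ?y0.
Qed.

End JacobiGegenbauer.

(** * The Gegenbauer weight *)

Section GegenbauerIntegral.
Variables (R : realType).
Local Notation mu := (@lebesgue_measure R).
Implicit Types (x t a e r : R) (p q : {poly R}).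

Lemma one_sub_sqr_gt0 t : -1 < t < 1 -> 0 < 1 - t ^+ 2.
Proof.
by move=> /andP[h1 h2]; have : 0 < (1 - t) * (1 + t); [rewrite mulr_gt0; lra|nra].
Qed.

Lemma one_sub_sqr_le1 t : 1 - t ^+ 2 <= 1.
Proof. by rewrite gerBl sqr_ge0. Qed.

Lemma one_sub_sqr_ge0 t : -1 <= t <= 1 -> 0 <= 1 - t ^+ 2.
Proof.
by move=> /andP[h1 h2]; have : 0 <= (1 - t) * (1 + t); [rewrite mulr_ge0; lra|nra].
Qed.

Lemma is_derive_one_sub_sqr t : is_derive t 1 (fun x : R => 1 - x ^+ 2) (- (2 * t)).
Proof.
have -> : (fun x : R => 1 - x ^+ 2) = horner (1 - 'X^2).
  by apply/funext => x; rewrite !hornerE.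
have -> : - (2 * t) = (1 - 'X^2)^`().[t].
  by rewrite derivB derivC derivXn !hornerE /=; ring.
exact: is_derive_poly.
Qed.

Lemma is_derive_powR_one_sub_sqr e t : -1 < t < 1 ->
  is_derive t 1 (fun x : R => (1 - x ^+ 2) `^ e)
    (e * (1 - t ^+ 2) `^ (e - 1) * - (2 * t)).
Proof.
move=> t1.
exact: (@is_derive1_comp _ (fun z => z `^ e) (fun x : R => 1 - x ^+ 2) t _ _
  (is_derive1_powR e (one_sub_sqr_gt0 t1)) (is_derive_one_sub_sqr t)).
Qed.

Lemma continuous_powR_one_sub_sqr e t : -1 < t < 1 ->
  {for t, continuous (fun x : R => (1 - x ^+ 2) `^ e)}.
Proof.
move=> t1; apply: differentiable_continuous; apply/derivable1_diffP.
by have [] := is_derive_powR_one_sub_sqr e t1.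
Qed.

Lemma measurable_powR_one_sub_sqr e :
  measurable_fun setT (fun x : R => (1 - x ^+ 2) `^ e).
Proof.
apply: (measurableT_comp (measurable_powR e)).
by apply: measurable_funB => //; exact: measurable_funX.
Qed.

(* Every Gegenbauer weight with [n >= 2] is dominated by [1] plus this one. *)
Lemma arcsine_integrable :
  mu.-integrable `[-1, 1] (EFin \o (fun t => (1 - t ^+ 2) `^ (- 2^-1))).
Proof.
have mf := measurable_powR_one_sub_sqr (- 2^-1).
apply/integrableP; split.
  by apply/measurable_EFinP; exact: measurable_funTS.
pose f (t : R) : \bar R := ((1 - t ^+ 2) `^ (- 2^-1))%:E.
have f0 t : (0 <= f t)%E by rewrite lee_fin powR_ge0.
rewrite (_ : integral _ _ _ = (\int[mu]_(t in `[(-1)%R, 1%R]) f t)%E); last first.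
  by apply: eq_integral => t _; rewrite /= ger0_norm // powR_ge0.
have mfE D : measurable D -> measurable_fun D f.
  by move=> mD; apply/measurable_EFinP; exact: measurable_funTS.
rewrite integral_itv_bndoo; last exact: mfE.
(* Compact intervals exhausting the open one; on each the integrand is continuous with primitive
   [asin], so its integral is at most [pi], and monotone convergence keeps this bound. *)
pose c (k : nat) : R := 1 - k.+2%:R^-1.
have c01 k : 0 < c k < 1.
  rewrite subr_gt0 gtrBl invr_gt0 ltr0n andbT invf_lt1 ?ltr0n //.
  by rewrite ltr1n.
have nd : nondecreasing_seq (fun k => `[- c k, c k]%classic : set R).
  apply/nondecreasing_seqP => k; apply/subsetPset => x /=.
  rewrite !in_itv /= => /andP[h1 h2].
  have : c k <= c k.+1 by rewrite lerB // lef_pV2 ?posrE ?ltr0n // ler_nat.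
  by move: h1 h2; lra.
have bigE : `]-1, 1[%classic = \bigcup_k (`[- c k, c k]%classic : set R).
  apply/seteqP; split => [x /=|x [k _ /=]]; rewrite !in_itv /= => /andP[h1 h2]; last first.
    by have := c01 k; lra.
  have x1 : `|x| < 1 by rewrite ltr_norml h1.
  pose N := Num.bound (1 - `|x|)^-1.
  exists N => //=; rewrite in_itv /= -ler_norml /c.
  have d0 : 0 < 1 - `|x| by rewrite subr_gt0.
  have : (1 - `|x|)^-1 < N%:R.
    by rewrite /N archi_boundP // invr_ge0 ltW.
  move=> hN; rewrite lerBrDr addrC -lerBrDr.
  rewrite -[leRHS]invrK lef_pV2 ?posrE ?ltr0n ?invr_gt0 //.
  by rewrite (le_trans (ltW hN)) // ler_nat; lia.
have intE k : (\int[mu]_(t in `[(- c k)%R, c k]) f t <= pi%:E)%E.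
  have /andP[ck0 ck1] := c01 k.
  have sub t : - c k <= t <= c k -> -1 < t < 1 by move=> /andP[h1 h2]; apply/andP; lra.
  rewrite (@continuous_FTC2 _ _ (@asin R)); first last.
  - move=> t; rewrite in_itv /= => /andP[h1 h2].
    have t1 : -1 < t < 1 by apply: sub; rewrite !ltW.
    rewrite derive1E; have [_ ->] := is_derive1_asin t1.
    by rewrite powRN powR12_sqrt // ltW // one_sub_sqr_gt0.
  - have ac t : -1 < t < 1 -> {for t, continuous (@asin R)} by exact: continuous_asin.
    split.
    + move=> t; rewrite in_itv /= => /andP[h1 h2].
      have t1 : -1 < t < 1 by apply: sub; rewrite !ltW.
      by have [] := is_derive1_asin t1.
    + by apply/cvg_at_right_filter/ac; apply: sub; lra.
    + by apply/cvg_at_left_filter/ac; apply: sub; lra.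
  - apply: continuous_in_subspaceT => t; rewrite inE /= in_itv /= => /sub.
    exact: continuous_powR_one_sub_sqr.
  - lra.
  rewrite -EFinB lee_fin.
  have : -1 <= c k <= 1 by lra.
  have : -1 <= - c k <= 1 by lra.
  by move=> /asin_geNpi2 h1 /asin_lepi2 h2; lra.
rewrite bigE.
pose F (k : nat) := `[- c k, c k]%classic : set R.
have mF k : measurable (F k) by exact: measurable_itv.
have cv : (\int[mu]_(t in F k) f t)%E @[k --> \oo] -->
    (\int[mu]_(t in \bigcup_k F k) f t)%E.
  by apply: ge0_nondecreasing_set_cvg_integral => // k; exact: mfE.
have icv : cvgn (fun k => \int[mu]_(t in F k) f t)%E by apply: cvgP cv.
rewrite -(cvg_lim _ cv) //.
apply: (@le_lt_trans _ _ pi%:E); last exact: ltry.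
by apply: lime_le => //; near=> k; exact: intE.
Unshelve. all: by end_near. Qed.

Variable n : nat.
Hypothesis n_ge2 : (2 <= n)%N.
Local Notation w := (gegen_weight n).

Lemma gegen_weight_ge0 t : 0 <= w t.
Proof. exact: powR_ge0. Qed.

Lemma gegen_weight_le t : -1 <= t <= 1 -> w t <= 1 + (1 - t ^+ 2) `^ (- 2^-1).
Proof.
move=> /one_sub_sqr_ge0 t0; rewrite /gegen_weight.
have e0 : - 2^-1 <= (n%:R - 3) / 2 :> R.
  have : 2 <= n%:R :> R by rewrite ler_nat.
  lra.
move: t0; rewrite le_eqVlt => /predU1P[<-|t0].
  (* At an endpoint [powR] of 0 is 1 for exponent 0, that is for [n = 3], and 0 otherwise; the
     summand 1 of the bound covers both. *)
  by rewrite /powR eqxx; case: (_ == 0); case: (_ == 0); rewrite /=; lra.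
apply: (@le_trans _ _ ((1 - t ^+ 2) `^ (- 2^-1))); last by rewrite lerDr.
by apply: ger_powR => //; rewrite t0 one_sub_sqr_le1.
Qed.

Definition poly_bound p : R := \sum_(i < size p) `|p`_i|.

Lemma poly_boundP p t : -1 <= t <= 1 -> `|p.[t]| <= poly_bound p.
Proof.
rewrite -ler_norml => t1; rewrite horner_coef (le_trans (ler_norm_sum _ _ _)) //.
apply: ler_sum => i _; rewrite normrM normrX ler_piMr // exprn_ile1 //.
Qed.

Lemma horner_weight_integrable p :
  mu.-integrable `[-1, 1] (EFin \o (fun t => p.[t] * w t)).
Proof.
have mD : measurable (`[-1, 1]%classic : set R) by exact: measurable_itv.
pose g t : R := poly_bound p * (1 + (1 - t ^+ 2) `^ (- 2^-1)).
apply: (@le_integrable _ (measurableTypeR R) R mu _ mD _ (EFin \o g)) => //.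
- apply/measurable_EFinP; apply: measurable_funTS; apply: measurable_funM.
    exact: measurable_poly.
  exact: measurable_powR_one_sub_sqr.
- move=> t; rewrite /= in_itv /= => t1; rewrite lee_fin normrM.
  rewrite (ger0_norm (gegen_weight_ge0 t)) [leRHS]ger0_norm; last first.
    rewrite mulr_ge0 ?addr_ge0 ?powR_ge0 //.
    exact: le_trans (normr_ge0 _) (poly_boundP p t1).
  by rewrite ler_pM ?gegen_weight_ge0 ?poly_boundP ?gegen_weight_le.
- have I1 : mu.-integrable `[-1, 1] (EFin \o cst (1 : R)).
    apply: continuous_compact_integrable; first exact: segment_compact.
    by apply: continuous_subspaceT => t; exact: cst_continuous.
  have I2 : mu.-integrable `[-1, 1]
      (fun t : R => (1%:E + ((1 - t ^+ 2) `^ (- 2^-1))%:E)%E).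
    by apply: integrableD => //; exact: arcsine_integrable.
  have I3 : mu.-integrable `[-1, 1] (fun t : R =>
      ((poly_bound p)%:E * (1%:E + ((1 - t ^+ 2) `^ (- 2^-1))%:E))%E).
    exact: integrableZl.
  by apply: eq_integrable I3 => // t _; rewrite /= -EFinD -EFinM.
Qed.

Let mD : measurable (`[-1, 1]%classic : set R).
Proof. exact: measurable_itv. Qed.

Definition geg_integral p : R :=
  \int[mu]_(t in `[(-1 : R), 1]) (p.[t] * w t).
Local Notation L := geg_integral.

Lemma geg_integralD p q : L (p + q) = L p + L q.
Proof.
rewrite /geg_integral -RintegralD //; [|exact: horner_weight_integrable..].
by apply: eq_Rintegral => t _; rewrite hornerD mulrDl.
Qed.

Lemma geg_integralZ x p : L (x *: p) = x * L p.
Proof.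
rewrite /geg_integral -RintegralZl //; last exact: horner_weight_integrable.
by apply: eq_Rintegral => t _; rewrite hornerZ mulrA.
Qed.

Lemma geg_integral_ge0 p : (forall t, -1 <= t <= 1 -> 0 <= p.[t]) -> 0 <= L p.
Proof.
move=> p0; apply: Rintegral_ge0 => t; rewrite /= in_itv /= => t1.
by rewrite mulr_ge0 ?p0 ?gegen_weight_ge0.
Qed.

Lemma geg_integral1_gt0 : 0 < L 1.
Proof.
have nD : n%:R = (n - 2)%:R + 2 :> R by rewrite -natrD subnK.
(* On [[-1/2, 1/2]] the base [1 - t^2] lies in [[1/2, 1]] and [n] exceeds [(n - 3)/2], so [(1/2)^n]
   is a lower bound whatever the sign of the exponent. *)
pose m : R := (2^-1) `^ n%:R.
have m0 : 0 < m by exact: powR_gt0.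
have mw t : -2^-1 <= t <= 2^-1 -> m <= w t.
  move=> /andP[h1 h2]; have u2 : 2^-1 <= 1 - t ^+ 2 by nra.
  have u0 : 0 < 1 - t ^+ 2 by lra.
  apply: (@le_trans _ _ ((1 - t ^+ 2) `^ n%:R)).
    by apply: ge0_ler_powR => //; rewrite ?nnegrE; lra.
  apply: ger_powR; first by rewrite u0 one_sub_sqr_le1.
  by have : 0 <= n%:R :> R by []; lra.
have sub : (`[-2^-1, 2^-1]%classic : set R) `<=` `[-1, 1].
  by move=> t /=; rewrite !in_itv /=; lra.
have mE : measurable (`[-2^-1, 2^-1]%classic : set R) by exact: measurable_itv.
have I1 := horner_weight_integrable 1.
have I2 : mu.-integrable `[-2^-1, 2^-1] (EFin \o (fun t => (1 : {poly R}).[t] * w t)).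
  exact: integrableS I1.
apply: (@lt_le_trans _ _ (\int[mu]_(t in `[(-2^-1 : R), 2^-1]) m)).
  rewrite Rintegral_cst //= lebesgue_measure_itv /= lte_fin.
  have -> : (-2^-1 < 2^-1 :> R) by lra.
  by rewrite -EFinB /= mulr_gt0 //; lra.
apply: (@le_trans _ _ (\int[mu]_(t in `[(-2^-1 : R), 2^-1]) ((1 : {poly R}).[t] * w t))).
  apply: le_Rintegral => //.
    apply: continuous_compact_integrable; first exact: segment_compact.
    by apply: continuous_subspaceT => t; exact: cst_continuous.
  by move=> t; rewrite /= in_itv /= hornerC mul1r => /mw.
rewrite /L /Rintegral; apply: fine_le.
- exact: integrable_fin_num.
- exact: integrable_fin_num.
apply: ge0_subset_integral => //.
  by have /integrableP[] := I1.
by move=> t _; rewrite lee_fin hornerC mul1r gegen_weight_ge0.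
Qed.

(* The integrand is the derivative of [(1 - t^2)^((n - 1) / 2) q t], which vanishes
   at both endpoints; the weight itself may be unbounded there (for [n = 2]). *)
Lemma geg_integral_parts q :
  L ((1 - 'X^2) * q^`() - (n - 1)%:R *: ('X * q)) = 0.
Proof.
set p := _ - _.
pose f t := p.[t] * w t.
have fI : mu.-integrable `[-1, 1] (EFin \o f) by exact: horner_weight_integrable.
pose Phi (x : R) := \int[mu]_(t in `[(-1 : R), x]) (f t).
(* A natural power of a square root is continuous up to the endpoints and vanishes there since
   [n - 1 >= 1]; [powR] is used only inside, where it can be differentiated. Then [h] has derivative
   0 inside, hence equal end values. *)
pose W (t : R) := Num.sqrt (1 - t ^+ 2) ^+ (n - 1).
pose h (t : R) := Phi t - W t * q.[t].
have WE t : -1 < t < 1 -> W t = (1 - t ^+ 2) `^ ((n%:R - 1) / 2).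
  move=> t1; have t0 := ltW (one_sub_sqr_gt0 t1).
  rewrite /W -powR12_sqrt // -[LHS]powR_mulrn ?powR_ge0 // -powRrM; congr (_ `^ _).
  by rewrite natrB; [lra|lia].
have wc t : -1 < t < 1 -> {for t, continuous f}.
  move=> t1; apply: cvgM; first exact: continuous_horner.
  exact: continuous_powR_one_sub_sqr.
have hd t : t \in `]-1, 1[ -> is_derive t 1 h 0.
  rewrite in_itv /= => t1; have /andP[h1 h2] := t1.
  have [PhiD PhiE] : derivable Phi t 1 /\ derive1 Phi t = f t.
    by apply: (@continuous_FTC1_closed _ f (-1) t 1) => //; exact: wc.
  have dPhi : is_derive t 1 Phi (f t) by split=> //; rewrite -derive1E.
  have dW : is_derive t 1 W
      ((n%:R - 1) / 2 * (1 - t ^+ 2) `^ ((n%:R - 1) / 2 - 1) * - (2 * t)).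
    apply: near_eq_is_derive (is_derive_powR_one_sub_sqr _ t1).
    near=> x; apply/esym/WE; near: x.
    by apply: (@near_in_itvoo _ (-1) 1 t); rewrite in_itv.
  have dq : is_derive t 1 (horner q) (q^`()).[t] by exact: is_derive_poly.
  have := is_deriveB dPhi (is_deriveM dW dq).
  have -> : (Phi - W * horner q)%R = h by [].
  suff -> : f t - (W t *: q^`().[t] + q.[t] *:
     ((n%:R - 1) / 2 * (1 - t ^+ 2) `^ ((n%:R - 1) / 2 - 1) * - (2 * t))) = 0 by [].
  have wE : (1 - t ^+ 2) `^ ((n%:R - 1) / 2 - 1) = w t by congr (_ `^ _); lra.
  have WwE : W t = (1 - t ^+ 2) * w t.
    rewrite WE // -wE mulr_powRB1 //; first exact/ltW/one_sub_sqr_gt0.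
    have : 2 <= n%:R :> R by rewrite ler_nat.
    lra.
  rewrite wE WwE /f /p !hornerE natrB; last by lia.
  by rewrite /GRing.scale /=; field.
have hc : {within `[-1, 1], continuous h}.
  have c1 : {within `[-1, 1], continuous Phi}.
    by apply: parameterized_integral_continuous fI; lra.
  have Wc : continuous W.
    move=> t; apply: (@continuous_comp _ _ _ (fun t : R => Num.sqrt (1 - t ^+ 2))
      (fun z => z ^+ (n - 1))); last exact: exprn_continuous.
    apply: (@continuous_comp _ _ _ (fun t : R => 1 - t ^+ 2)); last exact: sqrt_continuous.
    apply: differentiable_continuous; apply/derivable1_diffP.
    by have [] := is_derive_one_sub_sqr t.
  move=> t; apply: cvgB; first exact: c1.
  apply: (continuous_subspaceT (f := fun t => W t * q.[t])) => x.
  by apply: cvgM; [exact: Wc|exact: continuous_horner].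
have le11 : (-1 <= 1 :> R) by lra.
have [c _] := MVT_segment le11 hd hc.
have W1 : W 1 = 0 by rewrite /W expr1n subrr sqrtr0 expr0n; case: eqP => //; lia.
have WN1 : W (- 1) = 0.
  by rewrite /W sqrrN expr1n subrr sqrtr0 expr0n; case: eqP => //; lia.
have PhiN1 : Phi (- 1) = 0 by rewrite /Phi set_itv1 Rintegral_set1.
by rewrite mul0r /h W1 WN1 !mul0r !subr0 PhiN1 subr0.
Unshelve. all: by end_near. Qed.

End GegenbauerIntegral.

(** * Orthogonality and Gegenbauer expansions *)

Section GegenbauerOrthogonality.
Variables (R : realType) (n : nat).
Hypothesis n_ge2 : (2 <= n)%N.
Local Notation P := (gegenbauer R n).
Local Notation L := (@geg_integral R n).
Local Notation c := (geg_down R n).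
Local Notation a := (geg_up R n).
Implicit Types (i j : nat) (p q : {poly R}).
Local Opaque gegenbauer.

Lemma geg_integral0 : L 0 = 0.
Proof. by rewrite -(scale0r 0) geg_integralZ // mul0r. Qed.

Lemma geg_integralN p : L (- p) = - L p.
Proof. by rewrite -scaleN1r geg_integralZ // mulN1r. Qed.

Lemma geg_integralB p q : L (p - q) = L p - L q.
Proof. by rewrite geg_integralD // geg_integralN. Qed.

Lemma geg_integral_sum (I : Type) (r : seq I) (f : I -> {poly R}) :
  L (\sum_(z <- r) f z) = \sum_(z <- r) L (f z).
Proof. exact: (big_morph _ (geg_integralD n_ge2) geg_integral0). Qed.

(** Integration by parts with [q = P i] links the integrals of [P i.+1] and [P i.-1]. The latter
    vanishes by induction, except for [i = 1], where its coefficient [1 - n * c 1] is zero. *)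
Lemma geg_integral_P i : L (P i.+1) = 0.
Proof.
elim/ltn_ind: i => i IH.
have := geg_integral_parts n_ge2 (P i).
have nD : (n - 1)%:R = (n - 2)%:R + 1 :> R by rewrite natr1; congr (_%:R); lia.
have -> : (1 - 'X^2) * (P i)^`() - (n - 1)%:R *: ('X * P i) = i%:R *: P i.-1 -
    (i%:R + ((n - 2)%:R + 1)) *: (a i *: P i.+1 + c i *: P i.-1).
  by rewrite gegenbauer_deriv // -gegenbauer_mulX // nD -!mul_polyC; ring.
rewrite geg_integralB !geg_integralZ // geg_integralD // !geg_integralZ //.
have ai := geg_up_gt0 R n i.
have d0 : 0 < i%:R + ((n - 2)%:R + 1) :> R by rewrite ltr_wpDl // ltr_wpDl.
case: i IH ai d0 => [|i] IH ai d0.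
  rewrite geg_down0 /= !mul0r !addr0 sub0r => /eqP.
  by rewrite oppr_eq0 !mulf_eq0 (gt_eqF ai) (gt_eqF d0) /= => /eqP.
have E0 : i.+1%:R * L (P i) - (i.+1%:R + ((n - 2)%:R + 1)) * (c i.+1 * L (P i)) = 0.
  case: i IH ai d0 => [|i] IH ai d0; last by rewrite IH // !mulr0 subr0.
  rewrite /geg_down; move: d0 => /lt0r_neq0 d0.
  have -> : 1%:R / (2 * 1%:R + (n - 2)%:R) = (1 + ((n - 2)%:R + 1))^-1 :> R.
    by rewrite mul1r; congr (_^-1); lra.
  by field; move: d0; rewrite addrA.
move=> E; have : (i.+1%:R + ((n - 2)%:R + 1)) * (a i.+1 * L (P i.+2)) = 0.
  by move: E E0 => /=; lra.
move=> /eqP; rewrite !mulf_eq0 (gt_eqF ai) (gt_eqF d0) /=.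
by move/eqP.
Qed.

(** Multiplication by ['X] is symmetric for the integral. Orthogonality then spreads from [j = 0],
    and positivity of the norms from [i = 0]. *)
Lemma geg_wave i j :
  a j * L (P i * P j.+1) =
  a i * L (P i.+1 * P j) + c i * L (P i.-1 * P j) - c j * L (P i * P j.-1).
Proof.
have E : L ('X * P i * P j) = L (P i * ('X * P j)) by congr L; ring.
rewrite !gegenbauer_mulX // mulrDl mulrDr -!scalerAl -!scalerAr in E.
rewrite !geg_integralD // !geg_integralZ // in E.
by rewrite E addrK.
Qed.

Lemma geg_orth_lt i j : (j < i)%N -> L (P i * P j) = 0.
Proof.
elim/ltn_ind: j i => -[|j] IH i ji.
  by case: i ji => // i _; rewrite gegenbauer0 mulr1 geg_integral_P.
have := geg_wave i j; rewrite (IH j _ i.+1) ?(IH j _ i.-1) //; [|lia..].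
have -> : c j * L (P i * P j.-1) = 0.
  case: j IH ji => [|j] IH ji; first by rewrite geg_down0 mul0r.
  by rewrite IH ?mulr0 //; lia.
rewrite !mulr0 addr0 subr0 => /eqP; rewrite mulf_eq0 gt_eqF ?geg_up_gt0 //=.
by move/eqP.
Qed.

Lemma geg_orth i j : i != j -> L (P i * P j) = 0.
Proof. by rewrite neq_ltn => /orP[] ij; [rewrite mulrC|]; exact: geg_orth_lt. Qed.

Lemma geg_norm_gt0 i : 0 < L (P i * P i).
Proof.
elim: i => [|i IH]; first by rewrite gegenbauer0 mulr1 geg_integral1_gt0.
have e0 : L (P i.+1 * P i.-1) = 0 by apply: geg_orth_lt; lia.
have e1 : L (P i.+2 * P i) = 0 by apply: geg_orth_lt; lia.
have := geg_wave i.+1 i; rewrite e0 e1 /= !mulr0 add0r subr0 => E.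
by rewrite -(pmulr_rgt0 _ (geg_up_gt0 R n i)) E mulr_gt0 ?geg_down_gt0.
Qed.

Lemma geg_expand p : exists f : nat -> R, p = \sum_(j < size p) f j *: P j.
Proof.
suff H N q : (size q <= N)%N -> exists f : nat -> R, q = \sum_(j < N) f j *: P j.
  exact: H.
elim: N q => [|N IH] q sq.
  exists (fun=> 0); rewrite big_ord0; apply/eqP.
  by rewrite -size_poly_eq0 -leqn0.
have lN : (P N)`_N != 0.
  have := size_gegenbauer R n_ge2 N; rewrite -[(P N)`_N]/((P N)`_(N.+1.-1)) => s.
  by rewrite -s -lead_coefE lead_coef_eq0 -size_poly_eq0 s.
pose x := q`_N / (P N)`_N.
have [|f fE] := IH (q - x *: P N).
  apply/leq_sizeP => j; rewrite leq_eqVlt => /predU1P[<-|Nj].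
    by rewrite coefB coefZ divfK // subrr.
  by rewrite coefB coefZ !nth_default ?mulr0 ?subr0 ?size_gegenbauer // (leq_trans sq).
exists (fun j => if j == N then x else f j); rewrite big_ord_recr /= eqxx.
rewrite (eq_bigr (fun j : 'I_N => f j *: P j)) -?fE ?subrK // => j _.
by rewrite ltn_eqF.
Qed.

Lemma geg_orth_size i q : (size q <= i)%N -> L (P i * q) = 0.
Proof.
move=> sq; have [f ->] := geg_expand q.
rewrite mulr_sumr geg_integral_sum big1 // => j _.
rewrite -scalerAr geg_integralZ // geg_orth_lt ?mulr0 //.
exact: leq_trans (ltn_ord j) sq.
Qed.

Lemma gegen_coefE p i : gegen_coef n (horner p) i = L (p * P i) / L (P i * P i).
Proof.
rewrite /gegen_coef /geg_integral; congr (_ / _);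
  by apply: eq_Rintegral => t _; rewrite ?hornerM ?expr2.
Qed.

Lemma gegen_coef0E p : gegen_coef n (horner p) 0 = L p / L 1.
Proof. by rewrite gegen_coefE gegenbauer0 !mulr1. Qed.

Lemma geg_series p :
  p = \sum_(j < size p) gegen_coef n (horner p) j *: P j.
Proof.
have [f fE] := geg_expand p.
rewrite {1}fE; apply: eq_bigr => i _; congr (_ *: _).
have -> : gegen_coef n (horner p) i =
    L ((\sum_(j < size p) f j *: P j) * P i) / L (P i * P i).
  by rewrite gegen_coefE -fE.
rewrite mulr_suml geg_integral_sum (bigD1 i) //=.
rewrite big1 => [|j ji]; last by rewrite -scalerAl geg_integralZ // geg_orth // mulr0.
by rewrite addr0 -scalerAl geg_integralZ // mulfK // lt0r_neq0 // geg_norm_gt0.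
Qed.

Lemma geg_integral_sqr_gt0 p : p != 0 -> 0 < L (p ^+ 2).
Proof.
move=> p0; rewrite lt_neqAle eq_sym geg_integral_ge0 ?andbT; last first.
  by move=> t _; rewrite horner_exp sqr_ge0.
apply: contraNneq p0 => Lp; apply/eqP.
pose f j := gegen_coef n (horner p) j.
have Lf j : L (p * P j) = f j * L (P j * P j).
  by rewrite /f gegen_coefE divfK // lt0r_neq0 // geg_norm_gt0.
have : L (p ^+ 2) = \sum_(j < size p) f j ^+ 2 * L (P j * P j).
  rewrite expr2 {1}(geg_series p) mulr_suml geg_integral_sum; apply: eq_bigr => j _.
  by rewrite -scalerAl geg_integralZ // [_ * p]mulrC Lf expr2 mulrA.
rewrite Lp => /esym/eqP; rewrite psumr_eq0 => [/allP H|j _]; last first.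
  by rewrite mulr_ge0 ?sqr_ge0 // ltW // geg_norm_gt0.
rewrite (geg_series p) big1 // => j _.
have /H := mem_index_enum j.
rewrite mulf_eq0 (gt_eqF (geg_norm_gt0 j)) orbF sqrf_eq0 => /eqP.
by rewrite /f => ->; rewrite scale0r.
Qed.

(** For squares, positivity is Parseval's identity; a nonnegative [p] bounded by [b] satisfies
    [p ^+ 2 <= b p] on [[-1, 1]]. *)
Lemma geg_integral_gt0 p : p != 0 -> (forall t, -1 <= t <= 1 -> 0 <= p.[t]) ->
  0 < L p.
Proof.
move=> p0 p_ge0; have b0 : 0 < poly_bound p + 1.
  rewrite ltr_wpDl // (le_trans (normr_ge0 p.[0])) // poly_boundP //.
  by apply/andP; split; lra.
rewrite -(pmulr_rgt0 _ b0); apply: (lt_le_trans (geg_integral_sqr_gt0 p0)).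
rewrite -geg_integralZ // -subr_ge0 -geg_integralB geg_integral_ge0 // => t t1.
have := p_ge0 t t1; have := poly_boundP p t1; rewrite !hornerE => h1 h2.
rewrite ger0_norm // in h1; rewrite subr_ge0 ler_wpM2r //.
lra.
Qed.

Lemma geg_add2_orth_size i q : (size q <= i)%N ->
  L ((1 - 'X^2) * gegenbauer R (n + 2) i * q) = 0.
Proof.
move=> sq; have k0 : (i + n - 1)%:R != 0 :> R by rewrite pnatr_eq0; lia.
have -> : (1 - 'X^2) * gegenbauer R (n + 2) i * q =
    ((n - 1)%:R / (i + n - 1)%:R) *: (P i * q - P i.+1 * ('X * q)).
  apply: (scalerI k0); rewrite [RHS]scalerA [X in _ = X *: _]mulrC divfK //.
  rewrite scalerAl -gegenbauer_add2 //.
  by rewrite -!mul_polyC; ring.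
rewrite geg_integralZ // geg_integralB !geg_orth_size ?subrr ?mulr0 //.
by rewrite (leq_trans (size_polyMleq _ _)) // size_polyX.
Qed.

Lemma geg_kernel_orth_size i q : (size q <= i)%N ->
  L ((1 - 'X) * geg_kernel R n i * q) = 0.
Proof.
move=> sq; rewrite geg_kernel_sub // -scalerAl geg_integralZ // mulrBl geg_integralB.
by rewrite !geg_orth_size ?subrr ?mulr0 // (leq_trans sq).
Qed.

End GegenbauerOrthogonality.

(** * The linear programming bound *)

Section SphericalCodes.
Variables (R : realType) (n : nat).
Hypothesis n_ge2 : (2 <= n)%N.
Local Notation P := (gegenbauer R n).
Local Notation L := (@geg_integral R n).
Variable C : {fset 'rV[R]_n}.
Hypothesis codeC : spherical_code C.
Implicit Types (x y : C) (p : {poly R}).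
Local Opaque gegenbauer.

Lemma code_sqr x : \sum_j val x 0 j ^+ 2 = 1.
Proof. by rewrite -(codeC (valP x)); apply: eq_bigr => j _; rewrite expr2. Qed.

Lemma zonal_gegenbauer x y i :
  meval (val y 0) (zonal (val x 0) i) = (P i).[dotp (val x) (val y)].
Proof.
elim/ltn_ind: i => -[|[|i]] IH.
- by rewrite zonal0 gegenbauer0 meval1 hornerC.
- rewrite zonal1 gegenbauer1 hornerX raddf_sum /=; apply: eq_bigr => j _.
  by rewrite mevalZ mevalXU.
apply: (mulfI (geg_coef_neq0 R n i)); rewrite meval_zonal ?code_sqr // !IH //.
have /(congr1 (horner^~ (dotp (val x) (val y)))) := gegenbauerS R n_ge2 i.+1.
by rewrite !hornerE => ->.
Qed.

Lemma gegenbauer_psd i :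
  0 <= \sum_(x : C) \sum_(y : C) (P i).[dotp (val x) (val y)].
Proof.
have := zonal_psd n_ge2 (index_enum C) i code_sqr.
rewrite exchange_big /=; congr (_ <= _); apply: eq_bigr => x _; apply: eq_bigr => y _.
exact: zonal_gegenbauer.
Qed.

(** Only [P 0] has a nonzero integral, and it contributes the square of the cardinality; every other
    term adds a nonnegative double sum. *)
Lemma geg_cone_energy p : geg_cone n p ->
  (#|` C|)%:R ^+ 2 * (L p / L 1) <=
  \sum_(x : C) \sum_(y : C) p.[dotp (val x) (val y)].
Proof.
elim=> [|z i q z0 _ IH].
  rewrite geg_integral0 // mul0r mulr0 sumr_ge0 // => x _; rewrite sumr_ge0 // => y _.
  by rewrite horner0.
rewrite geg_integralD // geg_integralZ // mulrDl mulrDr.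
have -> : \sum_(x : C) \sum_(y : C) (z *: P i + q).[dotp (val x) (val y)] =
   z * (\sum_(x : C) \sum_(y : C) (P i).[dotp (val x) (val y)]) +
   \sum_(x : C) \sum_(y : C) q.[dotp (val x) (val y)].
  rewrite mulr_sumr -big_split; apply: eq_bigr => x _ /=.
  by rewrite mulr_sumr -big_split; apply: eq_bigr => y _ /=; rewrite !hornerE.
apply: lerD => //; case: i => [|i]; last first.
  by rewrite geg_integral_P // mulr0 mul0r mulr0 mulr_ge0 ?gegenbauer_psd.
rewrite gegenbauer0 mulfK; last by rewrite lt0r_neq0 // geg_integral1_gt0.
rewrite [leLHS]mulrC ler_wpM2l //.
rewrite (eq_bigr (fun=> #|` C|%:R)) => [|x _]; last first.
  rewrite (eq_bigr (fun=> 1)) => [|y _]; last by rewrite hornerC.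
  by rewrite sumr_const cardfE.
by rewrite sumr_const [in leRHS]cardfE -[leRHS]mulr_natr -expr2 [in leLHS]cardfE.
Qed.

Lemma dotp_geN1 x y : -1 <= dotp (val x) (val y).
Proof.
have : 0 <= \sum_j (val x 0 j + val y 0 j) ^+ 2 by apply: sumr_ge0 => j _; exact: sqr_ge0.
have -> : \sum_j (val x 0 j + val y 0 j) ^+ 2 =
    \sum_j val x 0 j ^+ 2 + \sum_j val y 0 j ^+ 2 + 2 * dotp (val x) (val y).
  rewrite /dotp mulr_sumr -!big_split; apply: eq_bigr => j _ /=; ring.
by rewrite !code_sqr; lra.
Qed.

Lemma lp_bound p s : geg_cone n p ->
  (forall x y, x != y -> dotp (val x) (val y) <= s) ->
  (forall t, -1 <= t <= s -> p.[t] <= 0) ->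
  (#|` C|)%:R ^+ 2 * (L p / L 1) <= (#|` C|)%:R * p.[1].
Proof.
move=> cp Cs p0; apply: (le_trans (geg_cone_energy cp)).
have -> : #|` C|%:R * p.[1] = \sum_(x : C) p.[1].
  by rewrite sumr_const cardfE mulr_natl.
apply: ler_sum => x _; rewrite (bigD1 x) //= (codeC (valP x)) gerDl.
by apply: sumr_le0 => y yx; rewrite p0 // dotp_geN1 Cs // eq_sym.
Qed.

End SphericalCodes.

(** * Levenshtein nodes and weights *)

Section ProductXsubC.
Variables (R : realFieldType) (I : finType) (alpha : I -> R).
Implicit Types (A : {set I}) (i : I) (x : R).

Definition nodal A : {poly R} := \prod_(i in A) ('X - (alpha i)%:P).

Lemma nodal_horner A x : (nodal A).[x] = \prod_(i in A) (x - alpha i).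
Proof. by rewrite horner_prod; apply: eq_bigr => i _; rewrite hornerXsubC. Qed.

Lemma size_nodal A : size (nodal A) = #|A|.+1.
Proof. by rewrite /nodal -big_enum size_prod_XsubC -cardE. Qed.

Lemma nodal_monic A : nodal A \is monic.
Proof. by apply: monic_prod => i _; exact: monicXsubC. Qed.

Lemma nodal_root A i : i \in A -> (nodal A).[alpha i] = 0.
Proof. by move=> iA; rewrite nodal_horner (bigD1 i) //= subrr mul0r. Qed.

Lemma nodal_gt0 A x : (forall i, i \in A -> alpha i < x) -> 0 < (nodal A).[x].
Proof. by move=> h; rewrite nodal_horner prodr_gt0 // => i /h; rewrite subr_gt0. Qed.

Lemma nodal_left A x : (forall i, i \in A -> x < alpha i) ->
  0 < (-1) ^+ #|A| * (nodal A).[x].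
Proof.
move=> h; rewrite nodal_horner -prodrN prodr_gt0 // => i /h.
by rewrite opprB subr_gt0.
Qed.

End ProductXsubC.

(** * One recurrence for both adjacent families *)

Section LevenshteinFamilies.
Variables (R : realType) (n : nat).
Hypothesis n_ge2 : (2 <= n)%N.
Local Opaque gegenbauer.

(* Up to positive factors, the polynomials [Q_i^e]. *)
Definition lev_family (e : bool) i : {poly R} :=
  if e then gegenbauer R (n + 2) i else geg_kernel R n i.

Lemma adj_jacobiE e i : exists2 x, 0 < x & adj_jacobi R n e i = x *: lev_family e i.
Proof.
case: e; rewrite /adj_jacobi /lev_family.
  have n2 : (2 <= n + 2)%N by lia.
  have [x x0 xE] := jacobi_gegenbauer R n2 i; exists x => //; rewrite -xE.
  by congr jacobi; rewrite natrD /= ?mulr1n; field.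
have [x x0 xE] := jacobi_kernel R n_ge2 i; exists x => //; rewrite -xE.
by rewrite mulr0n add0r.
Qed.

Lemma lev_family_cone e i : geg_cone n (lev_family e i).
Proof. by case: e; [exact: geg_cone_add2|exact: geg_cone_kernel]. Qed.

Definition lev_up (e : bool) i : R :=
  if e then geg_up R (n + 2) i else geg_down R n i.+1.
Definition lev_diag (e : bool) i : R :=
  if e then 0 else geg_down R n i - geg_down R n i.+1.
Definition lev_down (e : bool) i : R :=
  if e then geg_down R (n + 2) i else if i is 0 then 0 else geg_up R n i.

Lemma lev_family0 e : lev_family e 0 = 1.
Proof. by case: e; rewrite /= ?gegenbauer0 ?geg_kernel0. Qed.

Lemma lev_up_gt0 e i : 0 < lev_up e i.
Proof. by case: e; rewrite /= ?geg_up_gt0 ?geg_down_gt0. Qed.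

Lemma lev_down0 e : lev_down e 0 = 0.
Proof. by case: e; rewrite /= ?geg_down0. Qed.

Lemma lev_down_gt0 e i : 0 < lev_down e i.+1.
Proof. by case: e; rewrite /= ?geg_up_gt0 ?geg_down_gt0. Qed.

Lemma lev_family_mulX e i : 'X * lev_family e i = lev_up e i *: lev_family e i.+1 +
  lev_diag e i *: lev_family e i + lev_down e i *: lev_family e i.-1.
Proof.
case: e => /=; last exact: geg_kernel_mulX.
by rewrite gegenbauer_mulX ?scale0r ?addr0 //; lia.
Qed.

Lemma size_lev_family e i : size (lev_family e i) = i.+1.
Proof.
case: e => /=; first by rewrite size_gegenbauer //; lia.
elim: i => [|i IH]; first by rewrite geg_kernel0 size_poly1.
have r0 := lt0r_neq0 (geg_mass_gt0 R n i.+1).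
by rewrite geg_kernelS addrC size_polyDl size_scale // size_gegenbauer // IH.
Qed.

Lemma lev_family_gt0 e i t : 1 <= t -> 0 < (lev_family e i).[t].
Proof.
case: e => /= t1; last exact: geg_kernel_gt0.
by apply: (lt_le_trans ltr01); apply: gegenbauer_ge1 => //; lia.
Qed.

(** The recurrence supplies a greatest zero, so [xget] returns it and not its default. *)
Lemma lev_zeroP e k : (0 < k)%N ->
  greatest_root (lev_family e k) (lev_zero R n true e k).
Proof.
case: k => // k _.
have [z zE] := y_greatest_root (lev_family0 e) (lev_up_gt0 e) (lev_down0 e)
  (lev_down_gt0 e) (lev_family_mulX e) (lev_family_gt0 e) k.
rewrite /lev_zero /greatest_zero.
have [x x0 xE] := adj_jacobiE e k.+1.
have -> : jacobi (true%:R + (n%:R - 3) / 2) (e%:R + (n%:R - 3) / 2) k.+1 =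
    x *: lev_family e k.+1.
  by rewrite -xE /adj_jacobi; congr jacobi; rewrite /= ?mulr1n; field.
have rE y : root (x *: lev_family e k.+1) y = root (lev_family e k.+1) y.
  by rewrite rootZ // lt0r_neq0.
case: xgetP => [y _ [ry ymax]|/(_ z)[]]; last first.
  by split=> [|y]; rewrite rE //; [case: zE|move=> ry; case: zE => _; exact].
by split=> [|w rw]; [rewrite -rE|apply: ymax; rewrite rE].
Qed.

End LevenshteinFamilies.

Lemma size_mulp_leq (R : nzRingType) (p q : {poly R}) (a b : nat) :
  (size p <= a.+1)%N -> (size q <= b.+1)%N -> (size (p * q)%R <= (a + b).+1)%N.
Proof.
by move=> pa qb; rewrite (leq_trans (size_polyMleq _ _)) //; lia.
Qed.

Lemma size_1subX (R : nzRingType) : size (1 - 'X : {poly R}) = 2%N.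
Proof. by rewrite -opprB size_polyN size_XsubC. Qed.

Lemma size_1subXn (R : nzRingType) (m : nat) : (0 < m)%N ->
  size (1 - 'X^m : {poly R}) = m.+1.
Proof. by move=> m0; rewrite -opprB size_polyN size_XnsubC. Qed.

(** * Location of the nodes, signs of the weights, the Levenshtein polynomial *)

Section LevenshteinNodes.
Variables (R : realType) (n k : nat) (e : bool) (s : R) (alpha rho : 'I_(k + e) -> R).
Hypotheses (n_ge2 : (2 <= n)%N) (k_gt0 : (0 < k)%N).
Hypothesis s_itv : s \in `[-1, 1[.
Hypothesis s_lev : s \in lev_interval R n k e.
Hypothesis nodes : lev_nodes n s alpha.
Hypothesis weights : lev_weights n s alpha rho.
Local Notation L := (@geg_integral R n).
Local Notation nodal := (nodal alpha).
Local Notation K := (geg_kernel R n).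
Local Notation G := (gegenbauer R (n + 2)).
Local Notation y := (lev_family R n e).
Implicit Types (i j : 'I_(k + e)) (f : {poly R}) (t : R).
Local Opaque gegenbauer.

Let first : 'I_(k + e) := Ordinal (ltn_addr e k_gt0).
Let last_subproof : ((k + e).-1 < k + e)%N.
Proof. by rewrite prednK // addn_gt0 k_gt0. Qed.

Let last : 'I_(k + e) := Ordinal last_subproof.

Lemma lev_node_last : alpha last = s.
Proof. by have [_ _ h] := nodes; apply: h; rewrite /= prednK // addn_gt0 k_gt0. Qed.

Lemma lev_node_lt i j : (i < j)%N -> alpha i < alpha j.
Proof. by have [h _ _] := nodes; exact: h. Qed.

Lemma lev_node_le i j : (i <= j)%N -> alpha i <= alpha j.
Proof. by rewrite leq_eqVlt => /predU1P[/val_inj->|/lev_node_lt/ltW]. Qed.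

Lemma lev_node_inj : injective alpha.
Proof.
move=> i j ij; have [||/val_inj//] := ltngtP i j => /lev_node_lt;
  by rewrite ij ltxx.
Qed.

Lemma lev_node_le_s i : alpha i <= s.
Proof. by rewrite -lev_node_last lev_node_le //= -ltnS prednK // addn_gt0 k_gt0. Qed.

Lemma lev_s_lt1 : s < 1.
Proof. by move: s_itv; rewrite in_itv => /andP[]. Qed.

Lemma lev_s_geN1 : -1 <= s.
Proof. by move: s_itv; rewrite in_itv => /andP[]. Qed.

Lemma lev_node_lt1 i : alpha i < 1.
Proof. exact: le_lt_trans (lev_node_le_s i) lev_s_lt1. Qed.

Lemma lev_quadrature f : (size f <= 2 * k + e)%N -> f.[1] = 0 ->
  L f / L 1 = \sum_i rho i * f.[alpha i].
Proof.
move=> sf f1; rewrite -gegen_coef0E weights ?f1 ?mul0r ?add0r //.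
by rewrite /lev_index; move: k_gt0; lia.
Qed.

Lemma lev_quadrature1 f j : (size f <= 2 * k + e)%N -> f.[1] = 0 ->
  (forall i, i != j -> f.[alpha i] = 0) -> L f / L 1 = rho j * f.[alpha j].
Proof.
move=> sf f1 f0; rewrite lev_quadrature // (bigD1 j) //= big1 ?addr0 // => i /f0->.
by rewrite mulr0.
Qed.

Lemma lev_quadrature2 f i j : (size f <= 2 * k + e)%N -> f.[1] = 0 -> i != j ->
  (forall l, l != i -> l != j -> f.[alpha l] = 0) ->
  L f / L 1 = rho i * f.[alpha i] + rho j * f.[alpha j].
Proof.
move=> sf f1 ij f0; rewrite lev_quadrature // (bigD1 i) //= (bigD1 j) 1?eq_sym //=.
by rewrite big1 ?addr0 // => l /andP[li lj]; rewrite f0 ?mulr0.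
Qed.

(** The test polynomial [f * nodal A ^+ 2] is nonnegative on [[-1, 1]] and vanishes at 1 and at all
    nodes but [alpha j], so its positive integral is a multiple of [rho j] times its value there.
    Dividing out the square does not presuppose that [alpha j] lies in [[-1, 1]]. *)
Lemma lev_weight_sqr f (A : {set 'I_(k + e)}) j : f != 0 -> f.[1] = 0 ->
  (forall t, -1 <= t <= 1 -> 0 <= f.[t]) ->
  (forall i, i != j -> (i \in A) || (f.[alpha i] == 0)) ->
  (size f + 2 * #|A| <= 2 * k + e)%N -> 0 < rho j * f.[alpha j].
Proof.
move=> f0 f1 fge fA sf; pose g := f * nodal A ^+ 2.
have sg : (size g <= 2 * k + e)%N.
  rewrite size_Mmonic ?monic_exp ?nodal_monic //.
  have sA : (size (nodal A ^+ 2) <= (2 * #|A|).+1)%N.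
    by rewrite (leq_trans (size_poly_exp_leq _ _)) // size_nodal mulnC.
  by apply: leq_trans sf; rewrite -subn1 leq_subLR addnCA leq_add2l add1n.
have Lg : 0 < L g / L 1.
  apply: divr_gt0; last exact: geg_integral1_gt0.
  apply: geg_integral_gt0 => // [|t t1].
    by rewrite mulf_neq0 // monic_neq0 // monic_exp ?nodal_monic.
  by rewrite hornerM horner_exp mulr_ge0 ?fge ?sqr_ge0.
rewrite (@lev_quadrature1 g j) // in Lg; first last.
- move=> i /fA /orP[iA|/eqP fi]; rewrite hornerM ?fi ?mul0r //.
  by rewrite horner_exp nodal_root // expr2 !mul0r mulr0.
- by rewrite hornerM f1 mul0r.
move: Lg; rewrite hornerM mulrA horner_exp => Lg.
rewrite ltNge; apply/negP => h; move: Lg; rewrite ltNge => /negP; apply.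
by rewrite mulr_le0_ge0 ?sqr_ge0.
Qed.

Lemma lev_weight_gt0 j : e = false -> 0 < rho j.
Proof.
move=> e0; have hX t : (1 - 'X).[t] = 1 - t by rewrite !hornerE.
have : 0 < rho j * (1 - 'X).[alpha j].
  apply: (@lev_weight_sqr _ [set~ j]) => [||t|i ij|].
  - by rewrite -size_poly_eq0 size_1subX.
  - by rewrite hX subrr.
  - by rewrite hX; lra.
  - by rewrite !inE ij.
  - by rewrite size_1subX cardsC1 card_ord e0 /=; move: k_gt0; lia.
by rewrite hX pmulr_lgt0 // subr_gt0 lev_node_lt1.
Qed.

Lemma lev_family_ge0 (d : bool) m t : (0 < m)%N -> lev_zero R n true d m <= t ->
  0 <= (lev_family R n d m).[t].
Proof.
move=> m0 zt; have [/rootP rz zmax] := lev_zeroP R n_ge2 d m0.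
move: zt; rewrite le_eqVlt => /predU1P[<-|zt]; first by rewrite rz.
exact/ltW/(y_beyond (lev_family_gt0 n_ge2 d) zmax).
Qed.

Lemma lev_first_le i : alpha first <= alpha i.
Proof. exact: lev_node_le. Qed.

Lemma card_setC2 i j : i != j -> #|~: [set i; j]| = (k + e - 2)%N.
Proof.
move=> ij; have := cardsC [set i; j]; rewrite card_ord cards2 ij /= => E.
by apply/eqP; rewrite -(eqn_add2l 2) E subnKC // -E leq_addr.
Qed.

Lemma lev_inner_pos i : i \in ~: [set first; last] -> alpha first < alpha i < s.
Proof.
rewrite !inE negb_or => /andP[i1 i2]; rewrite -lev_node_last.
apply/andP; split; apply: lev_node_lt => /=.
  by rewrite lt0n; apply: contraNneq i1 => i0; apply/eqP/val_inj.
rewrite ltn_neqAle -ltnS prednK ?addn_gt0 ?k_gt0 // ltn_ord andbT.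
by apply: contraNneq i2 => i0; apply/eqP/val_inj.
Qed.

(** Vanishes at all nodes but the two extreme ones, so the quadrature of a multiple of it that
    vanishes at 1 has only two terms. *)
Let inner := nodal (~: [set first; last]).

Let inner_s : 0 < inner.[s].
Proof. by apply: nodal_gt0 => i /lev_inner_pos/andP[]. Qed.

Let inner_first : first != last -> 0 < (-1) ^+ (k + e - 2) * inner.[alpha first].
Proof.
by move=> fl; rewrite -(card_setC2 fl); apply: nodal_left => i /lev_inner_pos/andP[].
Qed.

Let inner_eq0 l : l != first -> l != last -> inner.[alpha l] = 0.
Proof. by move=> lf ll; rewrite nodal_root // !inE negb_or lf. Qed.

(* If [alpha first < -1], the polynomial [f] below is orthogonal to 1 although its
   quadrature sum is positive. *)
Lemma lev_first_geN1_odd : e = false -> -1 <= alpha first.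
Proof.
move=> e0; rewrite leNgt; apply/negP => a1.
have fl : first != last.
  by apply: contraTneq a1 => ->; rewrite lev_node_last -leNgt lev_s_geN1.
have k2 : (2 <= k)%N.
  move: fl; rewrite -(inj_eq val_inj) /= e0 addn0; move: k_gt0; lia.
(* The degrees fit exactly: [inner] has degree [k - 2], so [G k.-1] is orthogonal to it for
   [(1 - t^2) w], and [f] has degree [2k - 1]. The lower end of the interval for [s] gives [(G
   k.-1).[s] >= 0]. *)
pose f := (1 - 'X^2) * G k.-1 * inner.
have Lf : L f = 0.
  by apply: geg_add2_orth_size => //; rewrite size_nodal card_setC2 // e0; lia.
have sf : (size f <= 2 * k + e)%N.
  have -> : (2 * k + e = (2 + k.-1 + (k + e - 2)).+1)%N by rewrite e0; lia.
  apply: size_mulp_leq; last by rewrite size_nodal card_setC2.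
  by apply: size_mulp_leq; rewrite ?size_1subXn // size_gegenbauer //; lia.
have f1 : f.[1] = 0 by rewrite !hornerM !hornerE expr1n subrr !mul0r.
have E : rho first * f.[alpha first] + rho last * f.[s] = 0.
  rewrite -lev_node_last -(lev_quadrature2 sf f1 fl) ?Lf ?mul0r // => l lf ll.
  by rewrite hornerM inner_eq0 // mulr0.
have fs : 0 <= f.[s].
  rewrite !hornerM !hornerE mulr_ge0 ?(ltW inner_s) // mulr_ge0 //.
    by apply: one_sub_sqr_ge0; rewrite lev_s_geN1 (ltW lev_s_lt1).
  have := @lev_family_ge0 true k.-1 s; apply; first by lia.
  by move: s_lev; rewrite /lev_interval e0 in_itv => /andP[].
have fa : 0 < f.[alpha first].
  have n2 : (2 <= n + 2)%N by lia.
  have g0 := gegenbauer_leN1 n2 k.-1 (ltW a1); have h0 := inner_first fl.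
  rewrite /f; move: g0 h0; have -> : k.-1 = (k + e - 2).+1 by rewrite e0; lia.
  rewrite exprS !hornerM !hornerE.
  have := signrMK (k + e - 2) (1 : R); rewrite mulr1.
  set z := (-1) ^+ _; set g := (G _).[_]; set h := inner.[_] => zz g0 h0.
  have : 0 < (alpha first ^+ 2 - 1) * ((-1 * z * g) * (z * h)).
    by apply: mulr_gt0; [nra|apply: mulr_gt0 => //; lra].
  have -> : (-1 * z * g) * (z * h) = - (z * z) * (g * h) by ring.
  by rewrite zz; lra.
have r1 := lev_weight_gt0 first e0; have r2 := lev_weight_gt0 last e0.
have : 0 < rho first * f.[alpha first] + rho last * f.[s].
  by rewrite ltr_pwDl ?mulr_gt0 // mulr_ge0 // ltW.
by rewrite E ltxx.
Qed.

Lemma lev_node_N1 : e = true -> exists i, alpha i = -1.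
Proof.
move=> e0; have [_ h _] := nodes.
have /h[i iE] : root (node_poly n k e s) (-1).
  by rewrite /node_poly e0 rootE hornerM expr1 !hornerE addNr mul0r.
by exists i.
Qed.

(** The factor [1 - 'X^2] removes 1 and the node -1 together, leaving just enough degree for the
    squares. The sign of [1 - alpha j ^+ 2] stays in the conclusion until the nodes are located. *)
Lemma lev_weight_even i0 j : e = true -> alpha i0 = -1 -> j != i0 ->
  0 < rho j * (1 - alpha j ^+ 2).
Proof.
move=> e0 ai0 ji; have hX t : (1 - 'X^2).[t] = 1 - t ^+ 2 by rewrite !hornerE.
rewrite -hX; apply: (@lev_weight_sqr _ (~: [set i0; j])) => [||t t1|i ij|].
- by rewrite -size_poly_eq0 size_1subXn.
- by rewrite hX expr1n subrr.
- by rewrite hX one_sub_sqr_ge0.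
- rewrite !inE negb_or ij andbT; have [->|//] := eqVneq i i0.
  by rewrite hX ai0 sqrrN expr1n subrr eqxx.
- by rewrite size_1subXn // card_setC2 1?eq_sym // e0 /=; move: k_gt0; lia.
Qed.

(* This test polynomial both excludes nodes below -1 and gives the sign of the weight
   at the node -1, which no square can isolate. *)
Lemma lev_even_quadrature : e = true -> first != last ->
  [/\ rho first * ((1 - 'X) * K k * inner).[alpha first] +
      rho last * ((1 - 'X) * K k * inner).[s] = 0,
      0 <= ((1 - 'X) * K k * inner).[s] &
      alpha first <= -1 -> ((1 - 'X) * K k * inner).[alpha first] < 0].
Proof.
(* Here [inner] has degree [k - 1], so [K k] is orthogonal to it for [(1 - t) w], and [f] has the
   full degree [2k]; the lower end of the interval for [s] gives [(K k).[s] >= 0]. *)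
move=> e0 fl; set f := _ * inner; split.
- have Lf : L f = 0.
    by apply: geg_kernel_orth_size => //; rewrite size_nodal card_setC2 // e0; lia.
  have sf : (size f <= 2 * k + e)%N.
    have -> : (2 * k + e = (1 + k + (k + e - 2)).+1)%N by rewrite e0; move: k_gt0; lia.
    apply: size_mulp_leq; last by rewrite size_nodal card_setC2.
    by apply: size_mulp_leq; rewrite ?size_1subX // (size_lev_family R n_ge2 false).
  have f1 : f.[1] = 0 by rewrite !hornerM !hornerE subrr !mul0r.
  rewrite -lev_node_last -(lev_quadrature2 sf f1 fl) ?Lf ?mul0r // => l lf ll.
  by rewrite hornerM inner_eq0 // mulr0.
- rewrite !hornerM !hornerE mulr_ge0 ?(ltW inner_s) // mulr_ge0 //.
    by rewrite subr_ge0 ltW // lev_s_lt1.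
  apply: (@lev_family_ge0 false) => //.
  by move: s_lev; rewrite /lev_interval e0 in_itv => /andP[].
- move=> a1; have g0 := geg_kernel_leN1 n_ge2 k a1; have h0 := inner_first fl.
  move: g0 h0; have -> : (k + e - 2 = k.-1)%N by rewrite e0; lia.
  rewrite -{1 2 3}(prednK k_gt0) exprS !hornerM !hornerE.
  have := signrMK k.-1 (1 : R); rewrite mulr1 prednK //.
  set z := (-1) ^+ _; set g := (K _).[_]; set h := inner.[_] => zz g0 h0.
  have : 0 < (1 - alpha first) * ((-1 * z * g) * (z * h)).
    by apply: mulr_gt0; [lra|apply: mulr_gt0 => //; lra].
  have -> : (-1 * z * g) * (z * h) = - (z * z) * (g * h) by ring.
  by rewrite zz; lra.
Qed.

Lemma lev_s_gtN1 : e = true -> -1 < s.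
Proof.
move=> e0; rewrite lt_neqAle lev_s_geN1 andbT; apply/eqP => s1.
have [/rootP rz _] := lev_zeroP R n_ge2 false k_gt0.
have zs : lev_zero R n true false k <= -1.
  by move: s_lev; rewrite /lev_interval e0 in_itv s1 => /andP[].
by have := geg_kernel_leN1 n_ge2 k zs; rewrite [X in _ * X]rz mulr0 ltxx.
Qed.

(** A first node below -1 has negative weight by [lev_weight_even], and the test polynomial is
    negative there. In the two-node identity the first term is then positive and the second
    nonnegative, against their sum 0. *)
Lemma lev_first_even : e = true -> alpha first = -1.
Proof.
move=> e0; have [i0 ai0] := lev_node_N1 e0.
have [->//|i0f] := eqVneq first i0.
have a1 : alpha first < -1.
  rewrite lt_neqAle -ai0 lev_first_le andbT.
  by apply: contraNneq i0f => /lev_node_inj ->.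
have fl : first != last.
  by apply: contraTneq a1 => ->; rewrite lev_node_last -leNgt lev_s_geN1.
have li0 : last != i0.
  apply: contraTneq (lev_s_gtN1 e0) => li; rewrite -leNgt -lev_node_last li ai0.
  exact: lexx.
have [E fs fa] := lev_even_quadrature e0 fl.
have wf := lev_weight_even e0 ai0 i0f; have wl := lev_weight_even e0 ai0 li0.
have := fa (ltW a1); move: E fs; set x := _.[alpha first]; set z := _.[s] => E fs x0.
have rf : rho first < 0.
  by rewrite -(nmulr_lgt0 _ (_ : 1 - alpha first ^+ 2 < 0)) //; nra.
have rl : 0 < rho last.
  move: wl; rewrite lev_node_last pmulr_lgt0 // one_sub_sqr_gt0 //.
  by rewrite lev_s_gtN1 // lev_s_lt1.
have : 0 < rho first * x + rho last * z.
  by rewrite ltr_pwDl ?nmulr_rgt0 // mulr_ge0 // ltW.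
by rewrite E ltxx.
Qed.

Lemma lev_node_geN1 i : -1 <= alpha i.
Proof.
apply: le_trans (lev_first_le i); case e0: e.
  by rewrite lev_first_even.
exact: lev_first_geN1_odd.
Qed.

Lemma lev_weight_ge0 i : 0 <= rho i.
Proof.
case e0: e; last exact/ltW/lev_weight_gt0.
have af := lev_first_even e0.
have fl : first != last.
  apply: contraTneq (lev_s_gtN1 e0) => fl.
  by rewrite -lev_node_last -fl af ltxx.
have wpos j : j != first -> 0 < rho j.
  move=> jf; have := lev_weight_even e0 af jf; rewrite pmulr_lgt0 // one_sub_sqr_gt0 //.
  rewrite lev_node_lt1 andbT -af; apply: lev_node_lt; rewrite /= lt0n.
  by apply: contraNneq jf => j0; apply/eqP/val_inj.
have [->|/wpos/ltW//] := eqVneq i first.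
have [E fs fa] := lev_even_quadrature e0 fl.
have := fa _; rewrite af => /(_ (lexx _)).
have := wpos last; rewrite eq_sym fl => /(_ isT) rl.
move: E fs; rewrite af; set x := _.[-1]; set z := _.[s] => E fs x0.
rewrite -(nmulr_lle0 _ x0) -[leLHS](addrK (rho last * z)) E sub0r oppr_le0.
by rewrite mulr_ge0 // ltW.
Qed.

Let dbl := nodal [set i | node_mult i == 2%N].

Lemma lev_nodal_setT : nodal [set: 'I_(k + e)] = ('X + 1) ^+ e * (('X - s%:P) * dbl).
Proof.
have E A : nodal A = \prod_(i | i \in A) ('X - (alpha i)%:P) by [].
rewrite /dbl !E (eq_bigl xpredT) => [|i]; last by rewrite inE.
rewrite (bigD1 last) //= lev_node_last mulrCA; congr (_ * _).
have lastE i : (i.+1 == k + e)%N = (i == last).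
  by rewrite -[RHS](inj_eq val_inj) /= -[RHS]eqSS prednK // addn_gt0 k_gt0.
have [e0|e0] : e = true \/ e = false by case: e; [left|right].
  have fl : first != last.
    by rewrite -lastE /= e0 addn1 eqSS eq_sym -lt0n.
  rewrite (bigD1 first) //= lev_first_even //; congr (_ * _).
    by rewrite [X in _ ^+ X](_ : _ = 1%N) ?e0 // expr1 polyCN polyC1 opprK.
  apply: eq_bigl => i; rewrite !inE /node_mult lastE.
  have -> : e && (i == 0%N :> nat) = (i == first).
    by rewrite -[RHS](inj_eq val_inj) /=; move: (_ == _) => b; rewrite e0.
  by case: (i == last); case: (i == first).
rewrite [X in _ ^+ X](_ : _ = 0%N) ?e0 // expr0 mul1r.
apply: eq_bigl => i; rewrite !inE /node_mult lastE.
have -> : e && (i == 0%N :> nat) = false by move: (_ == _) => b; rewrite e0.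
by case: (i == last).
Qed.

Lemma lev_polyE : lev_poly alpha = dbl * nodal [set: 'I_(k + e)].
Proof.
rewrite /lev_poly /lev_multiset big_flatten /= big_map big_enum /=.
have -> : nodal [set: 'I_(k + e)] = \prod_i ('X - (alpha i)%:P).
  by apply: eq_bigl => i; rewrite inE.
have E A : nodal A = \prod_(i | i \in A) ('X - (alpha i)%:P) by [].
rewrite /dbl E [X in _ = X * _]big_mkcond -big_split /=; apply: eq_bigr => i _.
rewrite inE big_nseq iter_mulr_1 /node_mult.
by case: ifP => _ /=; rewrite ?mul1r ?expr1 ?expr2.
Qed.

Let u := (y k.-1).[s].
Let v := (y k).[s].
Let p : {poly R} := u *: y k - v *: y k.-1.

Lemma node_polyE : exists2 z, 0 < z & node_poly n k e s = z *: (('X + 1) ^+ e * p).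
Proof.
have [a a0 aE] := adj_jacobiE R n_ge2 e k.
have [b b0 bE] := adj_jacobiE R n_ge2 e k.-1.
exists (a * b); first exact: mulr_gt0.
rewrite /node_poly aE bE /p /u /v !hornerZ -!mul_polyC; ring.
Qed.

Lemma node_poly_nodal : exists2 z, z != 0 & node_poly n k e s = z *: nodal [set: 'I_(k + e)].
Proof.
have [_ hroot _] := nodes.
(* The zero polynomial would make [s + 1] a node, beyond the last one. *)
have N0 : node_poly n k e s != 0.
  apply/eqP => N0; have : root (node_poly n k e s) (s + 1) by rewrite N0 root0.
  move=> /hroot[i iE]; have := lev_node_le_s i; rewrite -iE; lra.
exists (lead_coef (node_poly n k e s)); first by rewrite lead_coef_eq0.
pose rs := [seq alpha i | i <- enum 'I_(k + e)].
have rsu : uniq rs by rewrite map_inj_uniq ?enum_uniq //; exact: lev_node_inj.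
have rsr : all (root (node_poly n k e s)) rs.
  by apply/allP => x /mapP[i _ ->]; apply/hroot; exists i.
have rss : size rs = (k + e)%N by rewrite size_map size_enum_ord.
have -> : nodal [set: 'I_(k + e)] = \prod_(z <- rs) ('X - z%:P).
  by rewrite big_map big_enum /=; apply: eq_bigl => i; rewrite inE.
apply: all_roots_prod_XsubC => //; last by rewrite uniq_rootsE.
apply/eqP; rewrite eqn_leq max_poly_roots // andbT rss.
have [z _ ->] := node_polyE.
apply: (leq_trans (size_scale_leq _ _)).
rewrite addnC; apply: size_mulp_leq.
  have : size ('X + 1 : {poly R}) = 2%N by rewrite -[1]opprK -polyC1 -polyCN size_XsubC.
  by case: e => [->|_]; rewrite ?expr0 ?size_poly1.
rewrite (leq_trans (size_polyD _ _)) // size_polyN geq_max.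
rewrite !(leq_trans (size_scale_leq _ _)) // size_lev_family // prednK //.
Qed.

Lemma lev_quasi_orthogonal : exists2 z, z != 0 & p = z *: (('X - s%:P) * dbl).
Proof.
have [a a0 aE] := node_polyE; have [b b0 bE] := node_poly_nodal.
exists (b / a); first by rewrite mulf_neq0 // invr_eq0 lt0r_neq0.
have X0 : ('X + 1) ^+ e != 0 :> {poly R}.
  by rewrite monic_neq0 // monic_exp // -[1]opprK -polyC1 -polyCN monicXsubC.
apply: (mulfI X0); apply: (scalerI (lt0r_neq0 a0)); rewrite -aE bE lev_nodal_setT.
by rewrite -[in RHS]scalerAr [RHS]scalerA [X in _ = X *: _]mulrC divfK // lt0r_neq0.
Qed.

(** The upper end of the interval enters here: [s] is at most the greatest zero of [y k]. *)
Lemma lev_signs : (forall m : nat, (m <= k.-1)%N -> 0 <= (y m).[s]) /\ v <= 0.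
Proof.
have H := quasi_orthogonal_signs (lev_family0 R n e) (lev_up_gt0 R n e)
  (lev_down0 R n e) (lev_down_gt0 R n e) (lev_family_mulX R n_ge2 e)
  (size_lev_family R n_ge2 e) (lev_family_gt0 n_ge2 e).
have := H k.-1 s (lev_zero R n true e k); rewrite prednK // -/u -/v -/p; apply.
- move=> x rx; have [_ hroot _] := nodes.
  have /hroot[i ->] : root (node_poly n k e s) x; last exact: lev_node_le_s.
  have [a _ ->] := node_polyE.
  by rewrite rootE hornerZ hornerM (rootP rx) !mulr0.
- exact: lev_zeroP.
- by move: s_lev; rewrite /lev_interval; case: e; rewrite in_itv => /andP[].
Qed.

(** One copy of [dbl] comes with ['X - s%:P] from the quasi-orthogonal polynomial [p], the other
    from the Christoffel-Darboux sum [S]. By [lev_signs] both have nonnegative coefficients in the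
    family [y]. *)
Lemma lev_poly_cone : geg_cone n (lev_poly alpha).
Proof.
have [z z0 pE] := lev_quasi_orthogonal; have [ys v0] := lev_signs.
have CD := christoffel_darboux (lev_family0 R n e) (lev_down0 R n e)
  (lev_down_gt0 R n e) (lev_family_mulX R n_ge2 e) k.-1 s.
have d_gt0 := cd_mass_gt0 (lev_up_gt0 R n e) (lev_down_gt0 R n e).
pose m := cd_mass (lev_up R n e) (lev_down R n e) k.-1 * lev_up R n e k.-1.
move: CD; rewrite prednK // -/u -/v -/p -/m; set S := cd_sum _ _ _ _ _ => CD.
have m0 : 0 < m by rewrite mulr_gt0 ?lev_up_gt0.
have SE : S = (m * z) *: dbl.
  apply: (mulfI (monic_neq0 (monicXsubC s))).
  by rewrite CD pE scalerA scalerAr.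
(* Both [p] and [S] carry the factor [z], so it enters squared and its unknown sign disappears. *)
have -> : lev_poly alpha = (z ^- 2 / m) *: (('X + 1) ^+ e * p * S).
  have c1 : z ^- 2 / m * (z * (m * z)) = 1.
    by move: (m) (lt0r_neq0 m0) => b b0; field; rewrite ?z0 ?b0.
  rewrite lev_polyE lev_nodal_setT pE SE -!mul_polyC.
  move: c1; set w := z ^- 2 / m; move: (w) (m) => a b c1.
  transitivity ((a * (z * (b * z)))%:P * (dbl * (('X + 1) ^+ e * (('X - s%:P) * dbl)))).
    by rewrite c1 mul1r.
  by ring.
have fc := lev_family_cone R n_ge2 e.
apply: geg_coneZ.
  by rewrite mulr_ge0 ?invr_ge0 ?sqr_ge0 // ltW.
apply: geg_coneM => //; first (apply: geg_coneM => //).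
- have c1 : geg_cone n (1 : {poly R}) by exact: (geg_cone_P R n 0).
  have cX : geg_cone n ('X + 1 : {poly R}).
    by apply: geg_coneD => //; exact: (geg_cone_P R n 1).
  by case: e; rewrite ?expr1 ?expr0.
- by rewrite /p -scaleNr; apply: geg_coneD; apply: geg_coneZ; rewrite ?oppr_ge0 ?ys.
apply: geg_cone_sum => i _; apply: geg_coneZ => //.
by rewrite mulr_ge0 ?(ltW (d_gt0 _)) // ys // -ltnS.
Qed.

Lemma lev_poly_factor : lev_poly alpha = ('X + 1) ^+ e * ('X - s%:P) * dbl ^+ 2.
Proof. by rewrite lev_polyE lev_nodal_setT; ring. Qed.

Lemma lev_poly_horner t :
  (lev_poly alpha).[t] = (t + 1) ^+ e * (t - s) * dbl.[t] ^+ 2.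
Proof.
have hX : ('X + 1).[t] = t + 1 by rewrite !hornerE.
by rewrite lev_poly_factor hornerM hornerM 2!horner_exp hornerXsubC hX.
Qed.

Lemma lev_poly_le0 t : -1 <= t <= s -> (lev_poly alpha).[t] <= 0.
Proof.
move=> /andP[t1 ts]; rewrite lev_poly_horner.
apply: mulr_le0_ge0; last exact: sqr_ge0.
by apply: mulr_ge0_le0; [rewrite exprn_ge0 //|]; lra.
Qed.

Lemma lev_poly_at1 : 0 < (lev_poly alpha).[1].
Proof.
rewrite lev_poly_horner.
apply: mulr_gt0; first apply: mulr_gt0.
- by rewrite exprn_gt0 //; lra.
- by rewrite subr_gt0 lev_s_lt1.
by rewrite exprn_gt0 //; apply: nodal_gt0 => i _; exact: lev_node_lt1.
Qed.

Lemma lev_poly_node i : (lev_poly alpha).[alpha i] = 0.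
Proof. by rewrite lev_polyE hornerM [X in _ * X]nodal_root ?inE // mulr0. Qed.

Lemma size_lev_poly : (size (lev_poly alpha) <= (lev_index k e).+1)%N.
Proof.
have X1 : ('X + 1 : {poly R}) = 'X - (-1)%:P by rewrite polyCN polyC1 opprK.
have := congr1 (fun q : {poly R} => size q) lev_nodal_setT.
rewrite X1 size_Mmonic ?monicMl ?nodal_monic ?monicXsubC //; last first.
  by rewrite -size_poly_eq0 size_exp_XsubC.
rewrite size_exp_XsubC size_Mmonic ?nodal_monic ?monic_neq0 ?monicXsubC //.
rewrite size_XsubC !size_nodal cardsT card_ord => E.
rewrite lev_polyE; apply: (leq_trans (size_polyMleq _ _)).
rewrite !size_nodal cardsT card_ord /lev_index; move: E k_gt0.
by set a := #|_|; set d : nat := e; clear; lia.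
Qed.

End LevenshteinNodes.

(** * Levenshtein's bound and the quadrature inequality *)

Section UniversalBound.
Variables (R : realType) (n k : nat) (e : bool) (s : R) (alpha rho : 'I_(k + e) -> R).
Hypotheses (n_ge2 : (2 <= n)%N) (k_gt0 : (0 < k)%N).
Hypothesis s_itv : s \in `[-1, 1[.
Hypothesis s_lev : s \in lev_interval R n k e.
Hypothesis nodes : lev_nodes n s alpha.
Hypothesis weights : lev_weights n s alpha rho.
Local Notation B := (lev_bound n k e s).
Local Opaque gegenbauer.

(** The Levenshtein polynomial vanishes at the nodes, so its zeroth coefficient is its value at 1
    over [B]; dividing the linear programming bound by [M] and by that positive value leaves the
    quotient form. *)
Lemma levenshtein_bound (M : nat) : codes n M s !=set0 -> (0 < M)%N ->
  M%:R / B <= 1.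
Proof.
move=> [C [codeC <- [_ Cs]]] M0.
have f1 := lev_poly_at1 n_ge2 k_gt0 s_itv s_lev nodes weights.
have := lp_bound n_ge2 codeC (s := s)
  (lev_poly_cone n_ge2 k_gt0 s_itv s_lev nodes weights).
have -> : @geg_integral R n (lev_poly alpha) / geg_integral n 1 = (lev_poly alpha).[1] / B.
  have sz := size_lev_poly n_ge2 k_gt0 s_itv s_lev nodes weights.
  rewrite -gegen_coef0E (weights sz) big1 ?addr0 // => i _.
  by rewrite lev_poly_node mulr0.
have Cs' (x y : C) : x != y -> dotp (val x) (val y) <= s.
  by move=> xy; apply: Cs; [exact: valP|exact: valP|apply: contraNneq xy => /val_inj ->].
move=> /(_ Cs' (lev_poly_le0 n_ge2 k_gt0 s_itv s_lev nodes weights)).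
move: M0; set m := #|` C| => M0.
have m0 : 0 < m%:R :> R by rewrite ltr0n.
rewrite expr2 -mulrA (ler_pM2l m0) mulrCA -[leRHS]mulr1 (ler_pM2l f1).
by [].
Qed.

Lemma test_function_low j : (0 < j <= lev_index k e)%N ->
  test_function n s alpha rho j = 0.
Proof.
case: j => // j jk.
have := weights (f := gegenbauer R n j.+1); rewrite size_gegenbauer // => /(_ jk).
rewrite gegen_coef0E geg_integral_P // mul0r gegenbauer_at1 // mul1r.
by rewrite /test_function => <-.
Qed.

Lemma test_function0 : test_function n s alpha rho 0 = 1.
Proof.
have := weights (f := gegenbauer R n 0); rewrite size_gegenbauer // => /(_ isT).
rewrite gegen_coef0E gegenbauer0 divff ?lt0r_neq0 ?geg_integral1_gt0 // hornerC mul1r.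
by rewrite /test_function gegenbauer0 => <-.
Qed.

Lemma quadrature_le (F : {poly R}) :
  (forall j, (1 <= j)%N -> gegen_coef n (horner F) j <= 0) ->
  (forall j, (2 * k + e <= j)%N -> 0 <= test_function n s alpha rho j) ->
  F.[1] / B + \sum_i rho i * F.[alpha i] <= gegen_coef n (horner F) 0.
Proof.
move=> F0 t0; pose c j := gegen_coef n (horner F) j.
have -> : F.[1] / B + \sum_i rho i * F.[alpha i] =
    \sum_(j < size F) c j * test_function n s alpha rho j.
  have E t : F.[t] = \sum_(j < size F) c j * (gegenbauer R n j).[t].
    by rewrite {1}(geg_series n_ge2 F) horner_sum; apply: eq_bigr => j _; rewrite hornerZ.
  rewrite E mulr_suml (eq_bigr (fun i => \sum_(j < size F)
    c j * (rho i * (gegenbauer R n j).[alpha i]))); last first.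
    by move=> i _; rewrite E mulr_sumr; apply: eq_bigr => j _; ring.
  rewrite exchange_big -big_split; apply: eq_bigr => j _ /=.
  by rewrite /test_function mulrDr mulr_sumr gegenbauer_at1 // mulr1.
have ct j : (0 < j)%N -> c j * test_function n s alpha rho j <= 0.
  move=> j0; have [jk|kj] := leqP j (lev_index k e).
    by rewrite test_function_low ?j0 // mulr0.
  by rewrite mulr_le0_ge0 ?F0 ?t0 //; move: kj k_gt0; rewrite /lev_index; clear; lia.
case sF : (size F) => [|m].
  have -> : F = 0 by apply/eqP; rewrite -size_poly_eq0 sF.
  by rewrite big_ord0 gegen_coef0E geg_integral0 // mul0r.
rewrite big_ord_recl test_function0 mulr1 gerDl.
by apply: sumr_le0 => j _; exact: ct.
Qed.

End UniversalBound.
Theorem theorem3p10 (R : realType) (n M k : nat) (e : bool) (s : R)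
    (h : R -> \bar R) (alpha rho : 'I_(k + e) -> R) (g : {poly R})
    (hn : (2 <= n)%N) (hM : (2 <= M)%N) (hk : (1 <= k)%N)
    (hs : s \in `[-1, 1[)
    (hC : codes n M s !=set0)
    (hh : abs_monotone h)
    (hI : s \in lev_interval R n k e)
    (halpha : lev_nodes n s alpha)
    (hrho : lev_weights n s alpha rho)
    (hg : hermite_interpolant (lev_multiset alpha) (fine \o h) g)
    (hR : forall j : nat, (2 * k + e <= j)%N ->
            0 <= test_function n s alpha rho j)
    (F : {poly R})
    (hF : feasible n s h (horner F))
    (hF1 : F.[1] <= (bound_poly n alpha g).[1]) :
  universal_upper_bound n M s h alpha rho g <=
    M%:R * (gegen_coef n (horner F) 0 * M%:R - F.[1]).
Proof.
have [_ Fh Fc] := hF; have [_ hfin _ _] := hh.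
have w0 := lev_weight_ge0 hn hk hs hI halpha hrho.
have a0 := lev_node_geN1 hn hk hs hI halpha hrho.
have ML := levenshtein_bound hn hk hs hI halpha hrho hC (ltnW hM).
have Q := quadrature_le hn hk hrho Fc hR.
have S : \sum_i rho i * fine (h (alpha i)) <= \sum_i rho i * F.[alpha i].
  apply: ler_sum => i _; rewrite ler_wpM2l //.
  have as_ := lev_node_le_s hk halpha i.
  have := Fh (alpha i); rewrite in_itv /= a0 as_ => /(_ isT).
  (* A node is at most [s < 1], hence away from the point 1 where [h] may be infinite. *)
  rewrite -[h (alpha i)]fineK ?lee_fin // hfin // in_itv /= a0.
  by apply: le_lt_trans as_ _; move: hs; rewrite in_itv => /andP[].
rewrite /universal_upper_bound.
set z := (bound_poly n alpha g).[1] in hF1 *; set H := \sum_i _ in S *.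
set m : R := M%:R in ML *; set B := lev_bound n k e s in ML Q *.
have m0 : 0 <= m by rewrite /m.
have h1 : (m / B - 1) * z <= (m / B - 1) * F.[1].
  by rewrite ler_wnM2l // subr_le0.
have h2 : m * (F.[1] / B + H) <= m * gegen_coef n (horner F) 0.
  by rewrite ler_wpM2l // (le_trans _ Q) // lerD2l.
have -> : m * (m / B - 1) * z + m ^+ 2 * H = m * ((m / B - 1) * z + m * H) by ring.
(* Without the common factor [m] the claim is the sum of [h1] and [h2], in which [m * F.[1] / B]
   cancels. *)
rewrite ler_wpM2l // [leRHS]addrC [gegen_coef _ _ _ * m]mulrC.
by move: h1 h2; rewrite !mulrDr; lra.
Qed.
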